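(* Let $(A,B)$ be controllable, let $\Sigma\in\mathbb{S}^n$ be positive semi-definite, and let $$\mathcal{F}=\{\lambda\in\mathbb{R}^p:\; N(\lambda)\succ 0,\ \lambda\in\mathcal{D},\ P_+(\lambda)\succ 0\}.$$ For $t>0$ and $\lambda\in\mathcal{F}$ put $$v_t(\lambda)=t\bigl(c^\top\lambda-\operatorname{trace}(\Sigma P_+(\lambda))\bigr)-\log\det N(\lambda)-\log\det P_+(\lambda)-\log\det(-R(\lambda))-\log\det\Delta(\lambda),$$ where $\Delta(\lambda)=P_+(\lambda)-P_-(\lambda)$. Let $t>0$ be fixed and let $(\lambda_k)$ be a convergent sequence of points $\lambda_k\in\mathcal{F}$. If the limit $\bar\lambda$ of $(\lambda_k)$ lies on the boundary of $\mathcal{F}$, then $v_t(\lambda_k)$ converges to $+\infty$ as $k\to\infty$.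
   Context: $\mathbb{S}^n$ is the set of real symmetric $n\times n$ matrices; $\prec,\succ$ refer to the definiteness order on symmetric matrices. Data: positive integers $n,m,p,r$; $A\in\mathbb{R}^{n\times n}$, $B\in\mathbb{R}^{n\times m}$, $c\in\mathbb{R}^p$, $\Sigma\in\mathbb{S}^n$; and affine matrix-valued functions of $\lambda\in\mathbb{R}^p$, $H(\lambda)=H_0+\sum_{i=1}^p\lambda_iH_i$ for $H\in\{N,Q,S,R\}$, with $Q_i\in\mathbb{S}^n$, $S_i\in\mathbb{R}^{n\times m}$, $R_i\in\mathbb{S}^m$, $N_i\in\mathbb{S}^r$ for $i=0,\dots,p$. For $\lambda$ with $R(\lambda)$ invertible and $P\in\mathbb{S}^n$ define $$F(P,\lambda)=A^\top P+PA+Q(\lambda)-(PB+S(\lambda))R(\lambda)^{-1}(PB+S(\lambda))^\top .$$ A solution $P\in\mathbb{S}^n$ of $F(P,\lambda)=0$ is called anti-stabilizing (resp. stabilizing) if all eigenvalues of $A-BR(\lambda)^{-1}(PB+S(\lambda))^\top$ have positive (resp. negative) real part; each is unique if it exists. $\mathcal{D}$ is the set of all $\lambda\in\mathbb{R}^p$ with $R(\lambda)\prec0$ for which $F(\cdot,\lambda)=0$ has an anti-stabilizing solution. For $\lambda\in\mathcal{D}$, $P_+(\lambda)$ denotes the anti-stabilizing and $P_-(\lambda)$ the stabilizing solution of $F(P,\lambda)=0$ (for $\lambda\in\mathcal{D}$ both exist, and $\Delta(\lambda)\succ0$). The boundary is the topological boundary in $\mathbb{R}^p$. *)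

(* Defs.v *)
From HB Require Import structures.
From mathcomp Require Import all_boot all_order all_algebra.
From mathcomp Require Import complex.
From mathcomp Require Import all_classical all_reals all_analysis.

Set Implicit Arguments.
Unset Strict Implicit.
Unset Printing Implicit Defensive.

Import Order.TTheory GRing.Theory Num.Theory.
Import numFieldNormedType.Exports.

Local Open Scope classical_set_scope.
Local Open Scope ring_scope.

Definition qform (K : realType) (n : nat) (M : 'M[K]_n) (x : 'cV[K]_n) : K :=
  (x^T *m M *m x) 0 0.

Definition posdef (K : realType) (n : nat) (M : 'M[K]_n) : Prop :=
  M^T = M /\ forall x : 'cV[K]_n, x != 0 -> 0 < qform M x.

Definition negdef (K : realType) (n : nat) (M : 'M[K]_n) : Prop :=
  M^T = M /\ forall x : 'cV[K]_n, x != 0 -> qform M x < 0.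

Definition possemidef (K : realType) (n : nat) (M : 'M[K]_n) : Prop :=
  M^T = M /\ forall x : 'cV[K]_n, 0 <= qform M x.

(* [B, AB, ..., A^(n-1)B] has full row rank. *)
Definition controllable (K : realType) (n m : nat)
    (A : 'M[K]_n) (B : 'M[K]_(n, m)) : Prop :=
  \rank (\mxrow_(j < n) (A ^+ j *m B)) = n.

Definition boundary (T : topologicalType) (E : set T) : set T :=
  closure E `\` E°.

(* H 0 + \sum_i l_i H (i+1): the constant term has index ord0, and the
   coordinate i : 'I_p of l multiplies H (lift ord0 i). *)
Definition affine (K : realType) (p a b : nat) (H : 'I_p.+1 -> 'M[K]_(a, b))
    (l : 'cV[K]_p) : 'M[K]_(a, b) :=
  H ord0 + \sum_(i < p) l i 0 *: H (lift ord0 i).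

Section Riccati.
Variables (K : realType) (n m p r : nat).
Variables (A : 'M[K]_n) (B : 'M[K]_(n, m)) (c : 'cV[K]_p) (Sigma : 'M[K]_n).
Variables (N : 'I_p.+1 -> 'M[K]_r) (Q : 'I_p.+1 -> 'M[K]_n)
          (S : 'I_p.+1 -> 'M[K]_(n, m)) (R : 'I_p.+1 -> 'M[K]_m).
Implicit Types (P : 'M[K]_n) (l : 'cV[K]_p).

(* Meaningful only when affine R l is invertible (invmx is the identity on
   singular matrices); below it is used only where affine R l is negative
   definite. *)
Definition riccati P l : 'M[K]_n :=
  A^T *m P + P *m A + affine Q l
  - (P *m B + affine S l) *m invmx (affine R l) *m (P *m B + affine S l)^T.

Definition closed_loop P l : 'M[K]_n :=
  A - B *m invmx (affine R l) *m (P *m B + affine S l)^T.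

Definition spectrum_re (M : 'M[K]_n) (C : pred K) : Prop :=
  forall z : K[i],
    eigenvalue (map_mx (real_complex K) M) z -> C (complex.Re z).

Definition anti_stabilizing l P : Prop :=
  [/\ P^T = P, riccati P l = 0
    & spectrum_re (closed_loop P l) (fun x => 0 < x)].

Definition stabilizing l P : Prop :=
  [/\ P^T = P, riccati P l = 0
    & spectrum_re (closed_loop P l) (fun x => x < 0)].

Definition riccati_domain : set 'cV[K]_p :=
  [set l | negdef (affine R l) /\ exists P, anti_stabilizing l P].

(* The default value 0 is returned only if no such solution exists. *)
Definition P_plus l : 'M[K]_n := xget 0 [set P | anti_stabilizing l P].
Definition P_minus l : 'M[K]_n := xget 0 [set P | stabilizing l P].

Definition Delta l : 'M[K]_n := P_plus l - P_minus l.

Definition feasible : set 'cV[K]_p :=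
  [set l | [/\ posdef (affine N l), riccati_domain l & posdef (P_plus l)]].

Definition barrier (t : K) l : K :=
  t * ((c^T *m l) 0 0 - \tr (Sigma *m P_plus l))
  - ln (\det (affine N l)) - ln (\det (P_plus l))
  - ln (\det (- affine R l)) - ln (\det (Delta l)).

End Riccati.

(* Main.v *)
Require Import Defs.
From HB Require Import structures.
From mathcomp Require Import all_boot all_order all_algebra.
From mathcomp Require Import complex polyrcf.
From mathcomp Require Import all_classical all_reals all_analysis.
From mathcomp Require Import ring lra.

Set Implicit Arguments.
Unset Strict Implicit.
Unset Printing Implicit Defensive.

Import Order.TTheory GRing.Theory Num.Theory.
Import numFieldNormedType.Exports.

Local Open Scope classical_set_scope.
Local Open Scope ring_scope.

(** The obstacle is that a limit of anti-stabilizing solutions only keeps its closed-loop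
    eigenvalues in the closed half-plane; the term with [Delta] is what excludes the imaginary axis.
    To avoid following eigenvalues through limits and perturbations, the half-plane condition is
    traded for the certificate [lyap]: a positive definite Y with A Y + Y A^T positive definite.
    This survives small changes of A, orders the solutions of the Riccati equation and makes the
    Lyapunov equation uniquely solvable among symmetric matrices. The passage from spectrum to
    certificate uses Cayley-Hamilton over [K[i]] instead of an integral of matrix exponentials.
    Eigenvalues themselves are handled only in the translation between the two notions and in
    [controllable_spectrum]. An ultrafilter makes all bounded quantities converge at once, without
    nested subsequences. *)

Definition bform (K : realType) n m (M : 'M[K]_(n, m)) (x : 'cV[K]_n) (y : 'cV[K]_m) : K :=
  (x^T *m M *m y) 0 0.

(** If v_t does not tend to +oo along lambda_k, some ultrafilter keeps v_t (lambda_k) bounded above.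
    Controllability keeps P_+ (lambda_k) and P_- (lambda_k) bounded along it, so they converge.
    All determinants in v_t stay bounded and the sum of their logarithms is bounded below, so no
    determinant tends to 0 and N, P_+, - R and Delta have positive definite limits. The limit of
    P_+ solves the Riccati equation at the limit point, and it is anti-stabilizing because the
    inverse W of the limit of Delta satisfies A_+ W + W A_+^T = B (- R)^-1 B^T with (A, B)
    controllable. Hence the limit point is feasible. A contraction argument on the Riccati
    equation shows that the feasible set is a neighbourhood of such a point, which therefore
    is not on the boundary. *)

(** * Bilinear forms of matrices *)

Lemma qform_bform (K : realType) n (M : 'M[K]_n) x : qform M x = bform M x x.
Proof. by []. Qed.

Section Bform.
Variables (K : realType) (n m : nat).
Implicit Types (M : 'M[K]_(n, m)) (x : 'cV[K]_n) (y : 'cV[K]_m).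

Lemma bformDl M N x y : bform (M + N) x y = bform M x y + bform N x y.
Proof. by rewrite /bform mulmxDr mulmxDl mxE. Qed.

Lemma bformNl M x y : bform (- M) x y = - bform M x y.
Proof. by rewrite /bform mulmxN mulNmx mxE. Qed.

Lemma bformZl a M x y : bform (a *: M) x y = a * bform M x y.
Proof. by rewrite /bform -scalemxAr -scalemxAl mxE. Qed.

Lemma bform0l x y : bform 0 x y = 0.
Proof. by rewrite /bform mulmx0 mul0mx mxE. Qed.

Lemma bformD M x y1 y2 : bform M x (y1 + y2) = bform M x y1 + bform M x y2.
Proof. by rewrite /bform mulmxDr mxE. Qed.

Lemma bformN M x y : bform M x (- y) = - bform M x y.
Proof. by rewrite /bform mulmxN mxE. Qed.

Lemma bformZ M x a y : bform M x (a *: y) = a * bform M x y.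
Proof. by rewrite /bform -scalemxAr mxE. Qed.

Lemma bform0 M x : bform M x 0 = 0.
Proof. by rewrite /bform mulmx0 mxE. Qed.

Lemma bformtr M x y : bform M^T y x = bform M x y.
Proof. by rewrite /bform -[RHS]trace_mx11 -mxtrace_tr trace_mx11 !trmx_mul trmxK mulmxA. Qed.

Lemma bformDm M x1 x2 y : bform M (x1 + x2) y = bform M x1 y + bform M x2 y.
Proof. by rewrite /bform linearD /= !mulmxDl mxE. Qed.

Lemma bformNm M x y : bform M (- x) y = - bform M x y.
Proof. by rewrite /bform linearN /= !mulNmx mxE. Qed.

Lemma bformZm M a x y : bform M (a *: x) y = a * bform M x y.
Proof. by rewrite /bform linearZ /= -!scalemxAl mxE. Qed.

Lemma bform_inj M N : (forall x y, bform M x y = bform N x y) -> M = N.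
Proof.
move=> h; apply/matrixP => i j.
have bE P : bform P (delta_mx i 0) (delta_mx j 0) = P i j.
  by rewrite /bform trmx_delta -rowE -colE !mxE.
by rewrite -!bE h.
Qed.

Lemma bform_sum M x y : bform M x y = \sum_i \sum_j x i 0 * M i j * y j 0.
Proof.
rewrite /bform -mulmxA mxE; apply: eq_bigr => i _.
by rewrite !mxE mulr_sumr; apply: eq_bigr => j _; rewrite mulrA.
Qed.
End Bform.

Lemma bformM (K : realType) n m q (M : 'M[K]_(n, m)) (N : 'M[K]_(m, q)) x y :
  bform (M *m N) x y = bform M x (N *m y).
Proof. by rewrite /bform !mulmxA. Qed.

Lemma bformMm (K : realType) n m q (M : 'M[K]_(n, m)) (N : 'M[K]_(m, q)) x y :
  bform (M *m N) x y = bform N (M^T *m x) y.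
Proof. by rewrite /bform !trmx_mul trmxK !mulmxA. Qed.

Lemma bformC (K : realType) n (M : 'M[K]_n) x y :
  M^T = M -> bform M x y = bform M y x.
Proof. by move=> Ms; rewrite -bformtr Ms. Qed.

Lemma addmxE (K : realType) n m (M N : 'M[K]_(n, m)) i j : (M + N) i j = M i j + N i j.
Proof. by rewrite mxE. Qed.
Lemma oppmxE (K : realType) n m (M : 'M[K]_(n, m)) i j : (- M) i j = - M i j.
Proof. by rewrite mxE. Qed.
Lemma scalemxE (K : realType) n m a (M : 'M[K]_(n, m)) i j : (a *: M) i j = a * M i j.
Proof. by rewrite mxE. Qed.

(** * Euclidean square norm and entrywise bounds *)

Definition sqnorm (K : realType) n (x : 'cV[K]_n) : K := \sum_i x i 0 ^+ 2.

Lemma sqnorm_ge0 (K : realType) n (x : 'cV[K]_n) : 0 <= sqnorm x.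
Proof. by apply: sumr_ge0 => i _; rewrite sqr_ge0. Qed.

Lemma sqnorm_gt0 (K : realType) n (x : 'cV[K]_n) : x != 0 -> 0 < sqnorm x.
Proof.
move=> x0; rewrite lt_def sqnorm_ge0 andbT; apply: contra x0 => /eqP h.
apply/eqP/colP => i; rewrite mxE; apply/eqP; rewrite -(sqrf_eq0 (x i 0)); apply/eqP.
by apply: (psumr_eq0P _ h) => // j _; rewrite sqr_ge0.
Qed.

Lemma bform1 (K : realType) n (x : 'cV[K]_n) : bform 1%:M x x = sqnorm x.
Proof.
rewrite /bform mulmx1 mxE; apply: eq_bigr => i _.
by rewrite mxE expr2.
Qed.

Lemma sqr_le_sqnorm (K : realType) n (x : 'cV[K]_n) i : x i 0 ^+ 2 <= sqnorm x.
Proof. by rewrite /sqnorm (bigD1 i) //= lerDl sumr_ge0 // => j _; rewrite sqr_ge0. Qed.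

Lemma coord_prod_le (K : realType) n m (x : 'cV[K]_n) (y : 'cV[K]_m) i j :
  `|x i 0 * y j 0| <= sqnorm x + sqnorm y.
Proof.
have hx := sqr_le_sqnorm x i; have hy := sqr_le_sqnorm y j.
apply: le_trans (lerD hx hy); rewrite ler_norml; apply/andP; split; nra.
Qed.

(* The entrywise l^1 norm, which unlike the sup norm of the library is submultiplicative. *)
Definition abssum (K : realType) n m (M : 'M[K]_(n, m)) : K := \sum_i \sum_j `|M i j|.

Lemma abssum_ge0 (K : realType) n m (M : 'M[K]_(n, m)) : 0 <= abssum M.
Proof. by apply: sumr_ge0 => i _; apply: sumr_ge0. Qed.

Lemma abssum_ge (K : realType) n m (M : 'M[K]_(n, m)) i j : `|M i j| <= abssum M.
Proof.
rewrite /abssum (bigD1 i) //= (bigD1 j) //= -addrA lerDl addr_ge0 ?sumr_ge0 //.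
by move=> k _; apply: sumr_ge0.
Qed.

Lemma bform_le_abssum (K : realType) n (M : 'M[K]_n) x :
  `|bform M x x| <= abssum M * (2 * sqnorm x).
Proof.
rewrite bform_sum /abssum mulr_suml; apply: le_trans (ler_norm_sum _ _ _) _.
apply: ler_sum => i _; rewrite mulr_suml; apply: le_trans (ler_norm_sum _ _ _) _.
apply: ler_sum => j _; rewrite mulrAC normrM [X in X <= _]mulrC.
apply: ler_wpM2l => //; apply: le_trans (coord_prod_le _ _ _ _) _; lra.
Qed.

(** * Definite and semidefinite matrices *)

Section Definite.
Variables (K : realType) (n : nat).
Implicit Types (M N W : 'M[K]_n) (x y : 'cV[K]_n).

Lemma posdef_psd M : posdef M -> possemidef M.
Proof.
move=> [Ms h]; split => // x; case: (eqVneq x 0) => [->|/h/ltW //].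
by rewrite qform_bform bform0.
Qed.

Lemma psdE M x : possemidef M -> 0 <= bform M x x.
Proof. by case=> _; apply. Qed.

Lemma CauchySchwarz_psd M x y : possemidef M ->
  bform M x y ^+ 2 <= bform M x x * bform M y y.
Proof.
move=> Mp; have Ms := Mp.1.
have h s t : 0 <= s ^+ 2 * bform M x x + 2 * s * t * bform M x y + t ^+ 2 * bform M y y.
  have := psdE (s *: x + t *: y) Mp.
  rewrite !(bformD, bformDm, bformZ, bformZm) [bform M y x]bformC //.
  by congr (_ <= _); ring.
set a := bform M x x in h *; set b := bform M x y in h *; set d := bform M y y in h *.
have a0 : 0 <= a by exact: psdE.
have d0 : 0 <= d by exact: psdE.
(* For d > 0 the choice s = d, t = - b turns [h] into d times the discriminant inequality. For d = 0
   the form is affine in t, and a nonzero slope b would allow the value -1. *)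
case: (ltrP 0 d) => [dp|dn]; last first.
  have d00 : d = 0 by lra.
  rewrite d00 in h *.
  case: (eqVneq b 0) => [->|b0]; first by rewrite mulr0 expr0n.
  have := h 1 (- (a + 1) / (2 * b)).
  have -> : 1 ^+ 2 * a + 2 * 1 * (- (a + 1) / (2 * b)) * b +
    (- (a + 1) / (2 * b)) ^+ 2 * 0 = -1 by field.
  by rewrite lerNr oppr0 ler10.
have := h d (- b).
have -> : d ^+ 2 * a + 2 * d * (- b) * b + (- b) ^+ 2 * d = d * (a * d - b ^+ 2) by ring.
by rewrite pmulr_rge0 // subr_ge0.
Qed.

Lemma psd_kernel M x : possemidef M -> bform M x x = 0 -> M *m x = 0.
Proof.
move=> Mp h; have Ms := Mp.1.
have hy y : bform M y x = 0.
  have := CauchySchwarz_psd y x Mp; rewrite h mulr0 => h2.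
  by apply/eqP; rewrite -sqrf_eq0 eq_le h2 sqr_ge0.
apply: bform_inj => y z; rewrite bform0l -[z]trmxK; move: (z^T) => z'.
have -> : z'^T = z'^T 0 0 *: 1%:M.
  by apply/matrixP => i j; rewrite !mxE !ord1 eqxx mulr1.
by rewrite bformZ /bform mulmx1 mulmxA -/(bform M y x) hy mulr0.
Qed.

Lemma psd_antisym M : possemidef M -> possemidef (- M) -> M = 0.
Proof.
move=> Mp Np; have h x : M *m x = 0.
  apply: psd_kernel => //; apply: le_anti.
  by have := psdE x Np; rewrite bformNl oppr_ge0 (psdE x Mp) => ->.
by apply: bform_inj => x y; rewrite bform0l /bform -mulmxA h mulmx0 mxE.
Qed.

Lemma psd_unit_posdef M : possemidef M -> M \in unitmx -> posdef M.
Proof.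
move=> Mp Mu; split; first exact: Mp.1.
move=> x x0; rewrite lt_def (psdE x Mp) andbT; apply: contra x0 => /eqP h.
by apply/eqP; rewrite -(mulKmx Mu x) (psd_kernel Mp h) mulmx0.
Qed.

Lemma posdef_unit M : posdef M -> M \in unitmx.
Proof.
move=> [Ms Mp]; rewrite -row_free_unit -kermx_eq0; apply/eqP/row_matrixP => i.
rewrite row0; apply/eqP; apply: contraT => h.
have /Mp : (row i (kermx M))^T != 0 by rewrite trmx_eq0.
by rewrite /qform trmxK -row_mul mulmx_ker row0 mul0mx mxE ltxx.
Qed.

Lemma posdefD M N : posdef M -> possemidef N -> posdef (M + N).
Proof.
move=> [Ms h] [Ns h']; split; first by rewrite linearD /= Ms Ns.
by move=> x x0; rewrite qform_bform bformDl ltr_wpDr ?h ?h'.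
Qed.

Lemma posdef1 : posdef (1%:M : 'M[K]_n).
Proof. by split; [exact: trmx1|move=> x x0; rewrite qform_bform bform1 sqnorm_gt0]. Qed.

Lemma psdD M N : possemidef M -> possemidef N -> possemidef (M + N).
Proof.
move=> [Ms h] [Ns h']; split; first by rewrite linearD /= Ms Ns.
by move=> x; rewrite qform_bform bformDl addr_ge0 ?h ?h'.
Qed.

Lemma psdZ a M : 0 <= a -> possemidef M -> possemidef (a *: M).
Proof.
move=> a0 [Ms h]; split; first by rewrite linearZ /= Ms.
by move=> x; rewrite qform_bform bformZl mulr_ge0 //; apply: h.
Qed.

Lemma posdef_inv M : posdef M -> posdef (invmx M).
Proof.
move=> Mp; have Mu := posdef_unit Mp; have [Ms h] := Mp.
have Is : (invmx M)^T = invmx M by rewrite trmx_inv Ms.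
split => // x x0.
have -> : qform (invmx M) x = qform M (invmx M *m x).
  by rewrite /qform trmx_mul Is !mulmxA mulmxKV.
apply: h; apply: contra x0 => /eqP e.
by rewrite -(mulKVmx Mu x) e mulmx0.
Qed.

Lemma posdef_opp M : negdef M -> posdef (- M).
Proof.
move=> [Ms h]; split; first by rewrite linearN /= Ms.
by move=> x x0; rewrite qform_bform bformNl oppr_gt0; apply: h.
Qed.

Lemma negdef_opp M : posdef (- M) -> negdef M.
Proof.
move=> [Ms h]; split; first by rewrite -[M]opprK linearN /= Ms.
by move=> x /h; rewrite !qform_bform bformNl oppr_gt0.
Qed.

(** Instead of compactness of the sphere: Cauchy-Schwarz for x and M^-1 x bounds |x|^4 by (x^T M
    x)(x^T M^-1 x), and the last factor is at most C |x|^2. The summand 1 in C keeps it positive in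
    dimension 0. *)
Lemma posdef_coercive M : posdef M ->
  exists2 mu, 0 < mu & forall x, mu * sqnorm x <= bform M x x.
Proof.
move=> Mp; have Mu := posdef_unit Mp; have Ip := posdef_inv Mp.
set C := 2 * abssum (invmx M) + 1.
have C0 : 0 < C by rewrite /C; have := abssum_ge0 (invmx M); lra.
exists C^-1; first by rewrite invr_gt0.
move=> x; case: (eqVneq x 0) => [->|x0].
  by rewrite bform0 /sqnorm big1 ?mulr0 // => i _; rewrite mxE expr0n.
have xp := sqnorm_gt0 x0.
have := CauchySchwarz_psd x (invmx M *m x) (posdef_psd Mp).
have -> : bform M x (invmx M *m x) = sqnorm x by rewrite -bformM mulmxV // bform1.
have -> : bform M (invmx M *m x) (invmx M *m x) = bform (invmx M) x x.
  by rewrite -bformM mulmxV // bformC ?trmx1 // /bform mulmx1 mulmxA.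
have hI : bform (invmx M) x x <= C * sqnorm x.
  apply: le_trans (ler_norm _) _; apply: le_trans (bform_le_abssum _ _) _.
  by rewrite /C; nra.
move=> h; have : sqnorm x ^+ 2 <= bform M x x * (C * sqnorm x).
  by apply: le_trans h _; apply: ler_wpM2l => //; apply: psdE (posdef_psd Mp).
rewrite expr2 mulrA ler_pM2r // => h2.
by rewrite ler_pdivrMl // mulrC.
Qed.

Lemma coercive_perturb M N mu : N^T = N ->
  (forall x, mu * sqnorm x <= bform M x x) -> 2 * abssum (N - M) < mu -> posdef N.
Proof.
move=> Ns h hN; split => // x x0; have xp := sqnorm_gt0 x0.
rewrite qform_bform; have := h x; have := bform_le_abssum (N - M) x.
rewrite ler_norml bformDl bformNl => /andP[h1 _] h2; nra.
Qed.
End Definite.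

(** * Lyapunov inequalities and the Lyapunov equation *)

Lemma trmxD (K : realType) n m (M N : 'M[K]_(n, m)) : (M + N)^T = M^T + N^T.
Proof. exact: linearD. Qed.
Lemma trmxN (K : realType) n m (M : 'M[K]_(n, m)) : (- M)^T = - M^T.
Proof. exact: linearN. Qed.
Lemma trmxZ (K : realType) n m a (M : 'M[K]_(n, m)) : (a *: M)^T = a *: M^T.
Proof. exact: linearZ. Qed.

(** Certificate that the spectrum lies in the open right half-plane. Both definiteness conditions
    are strict, so the same Y serves for all nearby A. *)
Definition lyap (K : realType) n (A : 'M[K]_n) : Prop :=
  exists Y, posdef Y /\ posdef (A *m Y + Y *m A^T).

Lemma singular_kernel (K : realType) n (V : 'M[K]_n) :
  V \notin unitmx -> exists2 x : 'cV[K]_n, x != 0 & V *m x = 0.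
Proof.
rewrite -unitmx_tr -row_free_unit -kermx_eq0 => /rowV0Pn[v /sub_kermxP h v0].
exists v^T; first by rewrite trmx_eq0.
by rewrite -[V]trmxK -trmx_mul h trmx0.
Qed.

Section Lyapunov.
Variables (K : realType) (n : nat).
Implicit Types (A W G Y : 'M[K]_n).

(** Take the least s >= 0 for which V = W + s Y is semidefinite. If s > 0, minimality makes V
    singular; on a kernel vector the form of A V + V A^T vanishes, so the form of A W + W A^T equals
    - s times a positive number there, a contradiction. *)
Lemma lyap_psd A W : lyap A -> W^T = W ->
  possemidef (A *m W + W *m A^T) -> possemidef W.
Proof.
move=> [Y [Yp Zp]] Ws Gp.
have [mu mu0 hmu] := posdef_coercive Yp.
have YP := posdef_psd Yp.
pose S := [set s : K | 0 <= s /\ possemidef (W + s *: Y)].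
have symV s : (W + s *: Y)^T = W + s *: Y.
  by rewrite linearD /= linearZ /= Ws Yp.1.
have S0 : S !=set0.
  exists (2 * abssum W / mu); split.
    by apply: divr_ge0; [rewrite mulr_ge0 ?abssum_ge0|exact: ltW].
  split => // x; rewrite qform_bform bformDl bformZl.
  have := bform_le_abssum W x; rewrite ler_norml => /andP[h _].
  have : 2 * abssum W * sqnorm x <= 2 * abssum W / mu * bform Y x x.
    rewrite -mulrA [X in _ <= X]mulrAC ler_pdivlMr // -!mulrA.
    apply: ler_wpM2l => //; apply: ler_wpM2l; first exact: abssum_ge0.
    by rewrite mulrC.
  by move=> h2; lra.
have Sinf : has_inf S by split => //; exists 0 => s [].
set s := inf S.
have s0 : 0 <= s by apply: lb_le_inf => // u [].
have Vp : possemidef (W + s *: Y).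
  split => // x; rewrite qform_bform leNgt; apply/negP => hx.
  have y0 : 0 <= bform Y x x by exact: psdE.
  set d := - bform (W + s *: Y) x x.
  have d0 : 0 < d by rewrite oppr_gt0.
  have e0 : 0 < d / (bform Y x x + 1) by rewrite divr_gt0 // ltr_wpDl.
  have [u [u0 /psdE - /(_ x) hu] us] := inf_adherent e0 Sinf.
  move: hu; rewrite bformDl bformZl => hu.
  have dE : d = - bform W x x - s * bform Y x x.
    by rewrite /d bformDl bformZl; ring.
  have : (u - s) * bform Y x x < d.
    apply: (@le_lt_trans _ _ (d / (bform Y x x + 1) * bform Y x x)).
      by apply: ler_wpM2r => //; move: us; rewrite -/s; lra.
    rewrite mulrAC ltr_pdivrMr; last by lra.
    by nra.
  by rewrite dE; lra.
have [s00|sn0] := eqVneq s 0.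
  by move: Vp; rewrite s00 scale0r addr0.
have sp : 0 < s by rewrite lt_def sn0.
have [Vu|Vnu] := boolP (W + s *: Y \in unitmx).
  have [nu nu0 hnu] := posdef_coercive (psd_unit_posdef Vp Vu).
  (* A step by which s can still be decreased: e <= s keeps the parameter nonnegative, and e Y stays
     below the coercivity constant nu. *)
  set e := Num.min s (nu / (2 * abssum Y + 1)).
  have aY := abssum_ge0 Y.
  have e0 : 0 < e by rewrite /e lt_min sp /= divr_gt0 //; lra.
  suff : S (s - e) by move/(ge_inf Sinf.2); rewrite -/s; lra.
  split; first by rewrite subr_ge0 /e ge_min lexx.
  split => // x; rewrite qform_bform.
  have -> : W + (s - e) *: Y = (W + s *: Y) - e *: Y by rewrite scalerBl addrA.
  rewrite bformDl bformNl bformZl; have := hnu x.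
  have := bform_le_abssum Y x; rewrite ler_norml => /andP[_ h].
  have eb : e * (2 * abssum Y + 1) <= nu.
    by rewrite -ler_pdivlMr; [rewrite /e ge_min lexx orbT|lra].
  have sx := sqnorm_ge0 x.
  have : e * bform Y x x <= e * (abssum Y * (2 * sqnorm x)).
    by apply: ler_wpM2l => //; exact: ltW.
  have := ler_wpM2r sx eb.
  have : 0 <= e * sqnorm x by rewrite mulr_ge0 // ltW.
  lra.
have [x x0 Vx] := singular_kernel Vnu.
have := psdE x Gp; have := Zp.2 x x0; rewrite qform_bform.
have -> : A *m W + W *m A^T =
    A *m (W + s *: Y) + (W + s *: Y) *m A^T - s *: (A *m Y + Y *m A^T).
  rewrite mulmxDr mulmxDl -!scalemxAl -!scalemxAr scalerDr.
  by apply/matrixP => i j; rewrite !(addmxE, oppmxE); ring.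
move=> hZ; rewrite bformDl bformNl bformZl [X in X - _]bformDl.
rewrite bformM Vx bform0 add0r bformMm symV Vx.
have -> : bform A^T 0 x = 0 by rewrite bformtr bform0.
by rewrite add0r oppr_ge0 pmulr_rle0 // leNgt hZ.
Qed.

(** The certificate is Y^-1, by congruence of A Y + Y A^T with Y^-1. *)
Lemma lyap_tr A : lyap A -> lyap A^T.
Proof.
move=> [Y [Yp Zp]]; exists (invmx Y); have Ip := posdef_inv Yp; split => //.
have Yu := posdef_unit Yp; rewrite trmxK.
have -> : A^T *m invmx Y + invmx Y *m A =
    invmx Y *m (A *m Y + Y *m A^T) *m (invmx Y)^T.
  by rewrite Ip.1 mulmxDr mulmxDl addrC !mulmxA mulmxK // mulVmx // mul1mx.
split; first by rewrite !trmx_mul trmxK Zp.1 mulmxA.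
move=> x x0; rewrite qform_bform -mulmxA bformMm bformM Ip.1; apply: Zp.2.
by apply: contra x0 => /eqP e; rewrite -(mulKVmx Yu x) e mulmx0.
Qed.

(** Transposing the equation changes only the sign of W - W^T, so comparing the two versions kills
    the skew part. *)
Lemma sym_skew_part A W G : G^T = G ->
  A *m (W + W^T) + (W + W^T) *m A^T + (W - W^T) = G ->
  W^T = W /\ A *m (W + W^T) + (W + W^T) *m A^T = G.
Proof.
move=> Gs e.
have e2 : A *m (W + W^T) + (W + W^T) *m A^T - (W - W^T) = G.
  rewrite -Gs -e !(trmxD, trmxN, trmx_mul, trmxK).
  rewrite ?mulmxDr ?mulmxDl.
  by apply/matrixP => i j; rewrite !(addmxE, oppmxE); ring.
have e3 : W^T = W.
  by apply/matrixP => i j; have := congr1 (fun M : 'M[K]_n => M i j) (etrans e (esym e2));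
    rewrite !(addmxE, oppmxE); lra.
by split => //; rewrite -e e3 subrr addr0.
Qed.

(* The Lyapunov operator on the symmetric part of W, plus the skew part of W: this makes
   injectivity on symmetric matrices enough for invertibility on all of 'M[K]_n. *)
Definition lyap_op A (W : 'M[K]_n) : 'M[K]_n :=
  A *m (W + W^T) + (W + W^T) *m A^T + (W - W^T).

Lemma lyap_op_is_linear A : linear (lyap_op A).
Proof.
move=> a U V; rewrite /lyap_op !(trmxD, trmxZ).
rewrite ?mulmxDr ?mulmxDl -?scalemxAl -?scalemxAr.
by apply/matrixP => i j; rewrite !(addmxE, oppmxE, scalemxE); ring.
Qed.

HB.instance Definition _ A :=
  GRing.isLinear.Build K _ _ _ (lyap_op A) (lyap_op_is_linear A).

Lemma lyap_op_inj A W : lyap A -> lyap_op A W = 0 -> W = 0.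
Proof.
move=> hA /(sym_skew_part (trmx0 _ _ _)) [Ws e].
rewrite Ws -mulr2n in e.
have psd0 : possemidef (0 : 'M[K]_n).
  by split; [exact: trmx0|move=> x; rewrite qform_bform bform0l].
have W2s : (W *+ 2)^T = W *+ 2 by rewrite mulr2n linearD /= Ws.
have : W *+ 2 = 0.
  apply: psd_antisym; apply: lyap_psd hA _ _; rewrite ?e //.
    by rewrite linearN /= W2s.
  by rewrite mulmxN mulNmx -opprD e oppr0.
by rewrite -scaler_nat => /eqP; rewrite scaler_eq0 pnatr_eq0 /= => /eqP.
Qed.

(** The solution is packaged as a linear map, so that it has an operator bound when it is iterated
    in the fixed-point argument of [ricc_pert_solve]. *)
Lemma lyap_solve A : lyap A -> exists f : {linear 'M[K]_n -> 'M[K]_n},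
  forall G, G^T = G -> (f G)^T = f G /\ A *m f G + f G *m A^T = G.
Proof.
move=> hA; set L := lin_mx (lyap_op A).
have Lu : L \in unitmx.
  rewrite -row_free_unit -kermx_eq0; apply/rowV0P => v /sub_kermxP.
  rewrite -[v]vec_mxK mul_vec_lin => /(congr1 vec_mx).
  by rewrite mxvecK linear0 => /(lyap_op_inj hA) ->; rewrite linear0.
(* On a symmetric W, [lyap_op] acts through W + W^T = 2 W, whence the factor 2. *)
exists (2%:R \*: (vec_mx \o mulmxr (invmx L) \o mxvec)) => G Gs.
set W := vec_mx (mxvec G *m invmx L).
have : lyap_op A W = G.
  apply: (can_inj mxvecK); rewrite -mul_vec_lin /W vec_mxK mulmxKV //.
move=> /(sym_skew_part Gs)[Ws].
have -> : W + W^T = 2%:R *: W by rewrite Ws scaler_nat mulr2n.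
by move=> e; split => //=; rewrite linearZ /= Ws.
Qed.
End Lyapunov.

(** * Spectra and Lyapunov certificates *)

Lemma prod_roots_char_poly (F : fieldType) n (M : 'M[F]_n) zs :
  char_poly M = \prod_(z <- zs) ('X - z%:P) ->
  \big[mulmx/1%:M]_(z <- zs) (M - z%:M) = 0.
Proof.
case: n M => [|n] M Mz; first by apply/matrixP => -[].
rewrite -(Cayley_Hamilton M) Mz rmorph_prod; apply: eq_bigr => z _.
by rewrite rmorphB /= horner_mx_X horner_mx_C.
Qed.

Lemma psd_congr (K : realType) n m (C : 'M[K]_(m, n)) (M : 'M[K]_n) :
  possemidef M -> possemidef (C *m M *m C^T).
Proof.
move=> [Ms Mp]; split; first by rewrite !trmx_mul trmxK Ms mulmxA.
by move=> x; rewrite qform_bform -mulmxA bformMm bformM; exact: Mp.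
Qed.

Lemma psd1 (K : realType) n : possemidef (1%:M : 'M[K]_n).
Proof. exact: posdef_psd (posdef1 _ _). Qed.

(* The product of the complex matrices A - z, z in zs, with z encoded as (Re z, Im z) and
   J playing the role of the imaginary unit. *)
Definition root_prod (K : realType) n (A J : 'M[K]_n) (zs : seq (K * K)) : 'M[K]_n :=
  foldr (fun z M => (A - (z.1%:M + z.2 *: J)) *m M) 1%:M zs.

(* Adding a root z, with D = A - z, w = 1 / Re z and Y' = w + w^2 D Y D^T, one gets
   A Y' + Y' A^T - 1 = w^2 D (A Y + Y A^T - 1) D^T + (1 + w D) (1 + w D)^T. *)
Lemma root_prod_psd (K : realType) n (A J : 'M[K]_n) zs :
  J^T = - J -> A *m J = J *m A -> (forall z, z \in zs -> 0 < z.1) ->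
  exists Y k, [/\ possemidef Y, 0 <= k &
    possemidef (A *m Y + Y *m A^T - 1%:M
                + k *: (root_prod A J zs *m (root_prod A J zs)^T))].
Proof.
move=> Js AJ; elim: zs => [_|[a b] zs IH hz] /=.
  have psd0 : possemidef (0 : 'M[K]_n).
    by split; [exact: trmx0|move=> x; rewrite qform_bform bform0l].
  exists 0, 1; split => //.
  by rewrite mulmx0 mul0mx trmx1 mulmx1 scale1r addr0 sub0r addNr.
have [z zzs|Y [k [Yp k0 Hp]]] := IH; first by apply: hz; rewrite inE zzs orbT.
have a0 : 0 < a by apply: (hz (a, b)); rewrite inE eqxx.
set D := A - (a%:M + b *: J); set w := a^-1.
have w0 : 0 <= w by rewrite invr_ge0 ltW.
have wa : w * a = 1 by rewrite mulVf // gt_eqF.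
have AD : A *m D = D *m A.
  by rewrite /D mulmxBr mulmxBl mulmxDr mulmxDl -scalemxAr -scalemxAl AJ scalar_mxC.
(* J is skew, so the imaginary part of the root drops out of D + D^T; with w a = 1 the linear terms
   become w (A + A^T) - 2, which is where the choice w = 1 / Re z is used. *)
have DDt : D + D^T = A + A^T - (a%:M + a%:M).
  rewrite /D !(trmxD, trmxN, trmxZ) Js tr_scalar_mx.
  by apply/matrixP => i j; rewrite !(addmxE, oppmxE, scalemxE); ring.
set Pi := root_prod A J zs in Hp *.
exists (w *: 1%:M + w ^+ 2 *: (D *m Y *m D^T)), (w ^+ 2 * k); split.
- by apply: psdD; apply: psdZ; rewrite ?sqr_ge0 //; [exact: psd1|exact: psd_congr].
- by rewrite mulr_ge0 ?sqr_ge0.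
set E := (X in possemidef X).
have -> : E = w ^+ 2 *: (D *m (A *m Y + Y *m A^T - 1%:M + k *: (Pi *m Pi^T)) *m D^T)
   + (w *: D + 1%:M) *m 1%:M *m (w *: D + 1%:M)^T.
  have e1 : A *m (D *m Y *m D^T) = D *m (A *m Y) *m D^T by rewrite !mulmxA AD.
  have e2 : D *m Y *m D^T *m A^T = D *m (Y *m A^T) *m D^T.
    by rewrite -!mulmxA -!trmx_mul AD.
  have e3 : w *: D + w *: D^T = w *: A + w *: A^T - (1%:M + 1%:M).
    by rewrite -scalerDr DDt scalerBr !scalerDr !scale_scalar_mx wa.
  have eA : A *m (w *: 1%:M + w ^+ 2 *: (D *m Y *m D^T))
      = w *: A + w ^+ 2 *: (D *m (A *m Y) *m D^T).
    by rewrite mulmxDr -!scalemxAr e1 mulmx1.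
  have eB : (w *: 1%:M + w ^+ 2 *: (D *m Y *m D^T)) *m A^T
      = w *: A^T + w ^+ 2 *: (D *m (Y *m A^T) *m D^T).
    by rewrite mulmxDl -!scalemxAl e2 mul1mx.
  rewrite /E eA eB; clearbody D; clear E; rewrite !(trmxD, trmxZ, trmx1, trmx_mul) !mulmx1 !mulmxA.
  rewrite !(mulmxDl, mulmxDr, mulmxN, mulNmx, mulmx1, mul1mx).
  rewrite -!(scalemxAr, scalemxAl) !mulmxA.
  apply/matrixP => i j; have := congr1 (fun M : 'M[K]_n => M i j) e3.
  by rewrite !(addmxE, oppmxE, scalemxE) => h; lra.
by apply: psdD; [apply: psdZ; rewrite ?sqr_ge0 //|]; apply: psd_congr => //; exact: psd1.
Qed.

Section Spectrum.
Variables (K : realType) (n : nat).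
Implicit Types (A : 'M[K]_n) (M : 'M[K[i]]_n).

Notation Re := (@complex.Re K).
Notation Im := (@complex.Im K).
Notation cplx A := (map_mx (real_complex K) A).

Lemma ReM (x y : K[i]) : Re (x * y) = Re x * Re y - Im x * Im y.
Proof. by case: x y => [a b] [c d]. Qed.
Lemma ImM (x y : K[i]) : Im (x * y) = Re x * Im y + Im x * Re y.
Proof. by case: x y => [a b] [c d]. Qed.

Lemma Re_sum (I : Type) (s : seq I) (F : I -> K[i]) :
  Re (\sum_(i <- s) F i) = \sum_(i <- s) Re (F i).
Proof. exact: raddf_sum. Qed.
Lemma Im_sum (I : Type) (s : seq I) (F : I -> K[i]) :
  Im (\sum_(i <- s) F i) = \sum_(i <- s) Im (F i).
Proof. exact: raddf_sum. Qed.

Lemma map_mx_ReM m q r (M : 'M[K[i]]_(m, q)) (N : 'M[K[i]]_(q, r)) :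
  map_mx Re (M *m N) = map_mx Re M *m map_mx Re N - map_mx Im M *m map_mx Im N.
Proof.
apply/matrixP => i j; rewrite !mxE Re_sum -sumrB; apply: eq_bigr => k _.
by rewrite ReM !mxE.
Qed.

Lemma map_mx_ImM m q r (M : 'M[K[i]]_(m, q)) (N : 'M[K[i]]_(q, r)) :
  map_mx Im (M *m N) = map_mx Re M *m map_mx Im N + map_mx Im M *m map_mx Re N.
Proof.
apply/matrixP => i j; rewrite !mxE Im_sum -big_split; apply: eq_bigr => k _.
by rewrite ImM !mxE.
Qed.

(** The eigenvectors of [eigenvalue] are row vectors, hence the transposes; u and w are the real and
    imaginary parts. *)
Lemma eigenvalue_Re_Im A z : eigenvalue (cplx A) z ->
  exists u w : 'cV[K]_n, [/\ (u != 0) || (w != 0),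
    A^T *m u = Re z *: u - Im z *: w & A^T *m w = Re z *: w + Im z *: u].
Proof.
move=> /eigenvalueP[v vA v0].
have ReA : map_mx Re (cplx A) = A by apply/matrixP => i j; rewrite !mxE.
have ImA : map_mx Im (cplx A) = 0 by apply/matrixP => i j; rewrite !mxE.
exists (map_mx Re v)^T, (map_mx Im v)^T; split.
- rewrite !trmx_eq0; apply: contraNT v0; rewrite negb_or !negbK => /andP[/eqP hr /eqP hi].
  apply/eqP/matrixP => i j; have := congr1 (fun M : 'rV[K]_n => M i j) hr.
  have := congr1 (fun M : 'rV[K]_n => M i j) hi; rewrite !mxE.
  by case: (v i j) => x y /= -> ->.
- rewrite -trmx_mul -!trmxZ -trmxN -trmxD; congr trmx.
  have := map_mx_ReM v (cplx A); rewrite vA ReA ImA mulmx0 subr0 => <-.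
  by apply/matrixP => i j; rewrite !mxE ReM.
- rewrite -trmx_mul -!trmxZ -trmxD; congr trmx.
  have := map_mx_ImM v (cplx A); rewrite vA ReA ImA mulmx0 add0r => <-.
  by apply/matrixP => i j; rewrite !mxE ImM.
Qed.

Lemma eigen_bform A (Y : 'M[K]_n) (a b : K) (u w : 'cV[K]_n) :
  Y^T = Y -> A^T *m u = a *: u - b *: w -> A^T *m w = a *: w + b *: u ->
  bform (A *m Y + Y *m A^T) u u + bform (A *m Y + Y *m A^T) w w
  = 2 * a * (bform Y u u + bform Y w w).
Proof.
move=> Ys hu hw.
rewrite !(bformDl, bformMm A) ![bform (Y *m _) _ _]bformM hu hw.
by rewrite !(bformD, bformDm, bformN, bformNm, bformZ, bformZm) [bform Y w u]bformC //; ring.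
Qed.

Lemma lyap_spectrum A : lyap A -> spectrum_re A (fun x => 0 < x).
Proof.
move=> [Y [Yp Zp]] z /eigenvalue_Re_Im[u [w [uw hu hw]]] /=.
have pos (M : 'M[K]_n) : posdef M -> 0 < bform M u u + bform M w w.
  move=> Mp; have Mq := posdef_psd Mp; case/orP: uw => [u0|w0].
    by rewrite ltr_pwDl ?psdE //; apply: Mp.2.
  by rewrite ltr_wpDl ?psdE //; apply: Mp.2.
have := pos _ Zp; rewrite (eigen_bform Yp.1 hu hw).
by rewrite pmulr_lgt0 ?pos // pmulr_rgt0.
Qed.

(** Multiplication by a complex matrix written on real and imaginary parts. It turns the
    factorization of the characteristic polynomial over [K[i]] into a product of real matrices, to
    which the real notion of semidefiniteness applies. *)
Definition realify M : 'M[K]_(n + n) :=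
  block_mx (map_mx Re M) (- map_mx Im M) (map_mx Im M) (map_mx Re M).

Lemma realifyM M N : realify (M *m N) = realify M *m realify N.
Proof.
rewrite /realify mulmx_block map_mx_ReM map_mx_ImM.
by rewrite !mulmxN !mulNmx opprD; congr block_mx; rewrite addrC.
Qed.

Lemma realifyB M N : realify (M - N) = realify M - realify N.
Proof.
rewrite /realify opp_block_mx add_block_mx.
by congr block_mx; apply/matrixP => i j; rewrite !mxE ?raddfB //= raddfB opprB opprK addrC.
Qed.

Definition imag_unit : 'M[K]_(n + n) := block_mx 0 (- 1%:M) 1%:M 0.

Lemma realify_scalar (z : K[i]) :
  realify z%:M = (Re z)%:M + Im z *: imag_unit.
Proof.
rewrite /realify /imag_unit scale_block_mx scalar_mx_block add_block_mx.
rewrite !scaler0 scalerN !addr0 !add0r.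
by congr block_mx; apply/matrixP => i j; rewrite !mxE; case: (i == j);
  rewrite /= ?mulr1n ?mulr0n ?mulr1 ?mulr0 ?oppr0.
Qed.

(** By Cayley-Hamilton the product over all roots vanishes, so [root_prod_psd] leaves a semidefinite
    Y with A2 Y + Y A2^T >= 1. As A2 is block diagonal with both blocks A, the upper left block of Y
    certifies A. *)
Lemma spectrum_lyap A : spectrum_re A (fun x => 0 < x) -> lyap A.
Proof.
move=> sp; pose Ac := cplx A.
have [zs pz] := closed_field_poly_normal (char_poly Ac).
rewrite (monicP (char_poly_monic _)) scale1r in pz.
pose zs2 := [seq (Re z, Im z) | z <- zs].
pose J := imag_unit; pose A2 := realify Ac.
have A2E : A2 = block_mx A 0 0 A.
  rewrite /A2 /realify; congr block_mx; apply/matrixP => i j; rewrite !mxE //.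
  by rewrite oppr0.
have Js : J^T = - J.
  by rewrite /J /imag_unit tr_block_mx opp_block_mx !trmx0 trmxN trmx1 !oppr0 opprK.
have AJ : A2 *m J = J *m A2.
  rewrite A2E /J !mulmx_block !(mulmx0, mul0mx, mulmxN, mulNmx, mulmx1, mul1mx).
  by rewrite !(add0r, addr0, oppr0).
have zpos z : z \in zs2 -> 0 < z.1.
  move=> /mapP[x xzs ->] /=; apply: sp.
  by rewrite eigenvalue_root_char -/Ac pz root_prod_XsubC.
have rp0 : root_prod A2 J zs2 = 0.
  have -> : root_prod A2 J zs2 = realify (\big[mulmx/1%:M]_(z <- zs) (Ac - z%:M)).
    rewrite /zs2; elim: (zs) => [|z s IH] /=.
      by rewrite big_nil realify_scalar /= scale0r addr0.
    by rewrite big_cons realifyM IH realifyB realify_scalar.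
  rewrite (prod_roots_char_poly pz) /realify; apply/matrixP => i j.
  by rewrite !mxE; case: splitP => k _; rewrite !mxE; case: splitP => l _;
    rewrite !mxE ?oppr0.
have [Y [k [Yp k0]]] := root_prod_psd Js AJ zpos.
rewrite rp0 mul0mx scaler0 addr0.
have ulE (M : 'M[K]_(n + n)) x : bform M (col_mx x 0) (col_mx x 0) = bform (ulsubmx M) x x.
  rewrite /bform tr_col_mx trmx0 -{1}[M]submxK mul_row_block !mul0mx !addr0.
  by rewrite mul_row_col mulmx0 addr0.
set U := ulsubmx Y.
have Us : U^T = U by rewrite trmx_ulsub Yp.1.
have Up : possemidef U.
  by split => // x; rewrite qform_bform -ulE psdE.
have ulA : ulsubmx (A2 *m Y + Y *m A2^T - 1%:M) = A *m U + U *m A^T - 1%:M.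
  rewrite -[Y]submxK A2E tr_block_mx !trmx0 !mulmx_block scalar_mx_block.
  by rewrite opp_block_mx !add_block_mx block_mxKul !mulmx0 !mul0mx !addr0.
move=> hp; have Zge x : sqnorm x <= bform (A *m U + U *m A^T) x x.
  have := psdE (col_mx x 0) hp.
  by rewrite ulE ulA bformDl bformNl bform1 subr_ge0.
have Zp : posdef (A *m U + U *m A^T).
  split; first by rewrite trmxD !trmx_mul trmxK Us addrC.
  by move=> x /sqnorm_gt0 x0; apply: lt_le_trans x0 (Zge x).
(* U is so far only semidefinite; a kernel vector of U would annihilate the positive definite form
   of A U + U A^T. *)
exists U; split => //; split => // x x0.
rewrite qform_bform lt_def psdE // andbT; apply/eqP => Ux.
have Ux0 := psd_kernel Up Ux.
have := Zp.2 x x0; rewrite qform_bform bformDl bformM Ux0 bform0 add0r.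
by rewrite bformMm Us Ux0 -bformtr bform0 ltxx.
Qed.
End Spectrum.

(** * Consequences of controllability *)

Section Controllable.
Variables (K : realType) (n m : nat) (A : 'M[K]_n) (B : 'M[K]_(n, m)).
Hypothesis AB : controllable A B.

Lemma controllable_left_kernel q (Z : 'M[K]_(q, n)) :
  (forall j, Z *m (A ^+ j *m B) = 0) -> Z = 0.
Proof.
move=> h; have rf : row_free (\mxrow_(j < n) (A ^+ j *m B)).
  by rewrite /row_free AB.
apply: (row_free_inj rf); rewrite mul0mx mul_mxrow.
by apply/matrixP => i k; rewrite mxE h !mxE.
Qed.

(** Iteration gives x^T A^j B = 0 for every j. V may be any predicate, so it covers both a kernel
    and the real span of the two parts of an eigenvector. *)
Lemma controllable_invariant (V : 'cV[K]_n -> Prop) :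
  (forall x, V x -> B^T *m x = 0 /\ V (A^T *m x)) -> forall x, V x -> x = 0.
Proof.
move=> hV x Vx; apply: trmx_inj; rewrite trmx0; apply: controllable_left_kernel => j.
elim: j x Vx => [|j IH] x /hV[Bx VAx].
  by rewrite expr0 mul1mx -[B]trmxK -trmx_mul Bx trmx0.
rewrite exprS -mulmxA mulmxA.
have -> : x^T *m A = (A^T *m x)^T by rewrite trmx_mul trmxK.
exact: IH.
Qed.

(** If Re z <= 0, [eigen_bform] forces B^T u = B^T w = 0. The feedback B L is then invisible on u
    and w, and their span is invariant under A^T inside the kernel of B^T. *)
Lemma controllable_spectrum (L : 'M[K]_(m, n)) (H : 'M[K]_m) (W : 'M[K]_n) :
  posdef H -> posdef W ->
  (A - B *m L) *m W + W *m (A - B *m L)^T = B *m H *m B^T ->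
  spectrum_re (A - B *m L) (fun x => 0 < x).
Proof.
move=> Hp Wp e z /eigenvalue_Re_Im[u [w [uw hu hw]]] /=.
have := eigen_bform Wp.1 hu hw; rewrite e => eG.
have GE x : bform (B *m H *m B^T) x x = bform H (B^T *m x) (B^T *m x).
  by rewrite -mulmxA bformMm bformM.
have G0 x : 0 <= bform H x x by exact: psdE (posdef_psd Hp).
have Gk x : bform H x x = 0 -> x = 0.
  by move=> h; apply/eqP; apply: contraT => /(Hp.2 x); rewrite qform_bform h ltxx.
have W0 : 0 < bform W u u + bform W w w.
  have Wq := posdef_psd Wp; case/orP: uw => [u0|w0].
    by rewrite ltr_pwDl ?psdE //; apply: Wp.2.
  by rewrite ltr_wpDl ?psdE //; apply: Wp.2.
rewrite ltNge; apply/negP => a0.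
have hG : bform (B *m H *m B^T) u u + bform (B *m H *m B^T) w w <= 0.
  by rewrite eG pmulr_lle0 // pmulr_rle0.
rewrite !GE in hG; have gu := G0 (B^T *m u); have gw := G0 (B^T *m w).
have Bu : B^T *m u = 0 by apply: Gk; lra.
have Bw : B^T *m w = 0 by apply: Gk; lra.
have AE x : B^T *m x = 0 -> (A - B *m L)^T *m x = A^T *m x.
  by move=> Bx; rewrite trmxD trmxN trmx_mul mulmxDl mulNmx -mulmxA Bx mulmx0 subr0.
rewrite !AE // in hu hw.
pose V x := exists s t, x = s *: u + t *: w.
have inv x : V x -> x = 0.
  move: x; apply: controllable_invariant => x [s [t ->]]; split.
    by rewrite mulmxDr -!scalemxAr Bu Bw !scaler0 addr0.
  exists (s * complex.Re z + t * complex.Im z), (t * complex.Re z - s * complex.Im z).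
  rewrite mulmxDr -!scalemxAr hu hw.
  by apply/matrixP => i j; rewrite !(addmxE, oppmxE, scalemxE); ring.
have u0 : u = 0 by apply: inv; exists 1, 0; rewrite scale1r scale0r addr0.
have w0 : w = 0 by apply: inv; exists 0, 1; rewrite scale1r scale0r add0r.
by move: uw; rewrite u0 w0 eqxx.
Qed.

(** The equation shows that the kernel of W is contained in that of B^T and invariant under A^T. *)
Lemma controllable_gramian (L : 'M[K]_(m, n)) (H : 'M[K]_m) (W : 'M[K]_n) :
  posdef H -> possemidef W ->
  (A - B *m L) *m W + W *m (A - B *m L)^T = B *m H *m B^T -> posdef W.
Proof.
move=> Hp Wp e; apply: psd_unit_posdef => //; apply: contraT => /singular_kernel[x x0 Wx].
suff inv (y : 'cV_n) : W *m y = 0 -> y = 0 by move: x0; rewrite (inv x Wx) eqxx.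
move: y {x x0 Wx}; apply: controllable_invariant => x Wx.
have Bx : B^T *m x = 0.
  apply/eqP; apply: contraT => /(Hp.2 _); rewrite qform_bform.
  have -> : bform H (B^T *m x) (B^T *m x) = bform (B *m H *m B^T) x x.
    by rewrite -mulmxA bformMm bformM.
  rewrite -e bformDl bformM Wx bform0 add0r bformMm Wp.1 Wx -bformtr bform0.
  by rewrite ltxx.
split => //; have : (B *m H *m B^T) *m x = 0 by rewrite -mulmxA Bx mulmx0.
rewrite -e mulmxDl -!mulmxA Wx mulmx0 add0r trmxD trmxN trmx_mul mulmxDl mulNmx.
by rewrite -mulmxA Bx mulmx0 subr0.
Qed.
End Controllable.

(** * Algebra and order of Riccati solutions at a fixed parameter *)

Section RiccatiEquation.
Variables (K : realType) (n m : nat) (A : 'M[K]_n) (B : 'M[K]_(n, m)).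
Variables (Q : 'M[K]_n) (S : 'M[K]_(n, m)) (R : 'M[K]_m).
Implicit Types P X : 'M[K]_n.

(* riccati, closed_loop at lambda unfold to ricc, cloop at affine Q lambda, affine S lambda,
   affine R lambda. *)
Definition ricc P : 'M[K]_n :=
  A^T *m P + P *m A + Q - (P *m B + S) *m invmx R *m (P *m B + S)^T.

Definition cloop P : 'M[K]_n := A - B *m invmx R *m (P *m B + S)^T.

(** The quadratic coefficient of the Riccati map, with the sign that makes it positive semidefinite
    for negative definite R. *)
Definition gain : 'M[K]_n := B *m (- invmx R) *m B^T.

Hypothesis Rn : negdef R.

Lemma invR_sym : (invmx R)^T = invmx R.
Proof. by rewrite trmx_inv Rn.1. Qed.

Lemma posdef_invR : posdef (- invmx R).
Proof.
have := posdef_inv (posdef_opp Rn); suff -> : invmx (- R) = - invmx R by [].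
have Nu := posdef_unit (posdef_opp Rn).
have Ru : R \in unitmx by move: Nu; rewrite -scaleN1r unitmxZ ?unitrN1.
by rewrite -scaleN1r invmxZ ?scaleN1r ?invrN1 ?unitmxZ ?unitrN1 // scaleN1r.
Qed.

Lemma psd_gain X : X^T = X -> possemidef (X *m gain *m X).
Proof.
move=> Xs; rewrite -{2}Xs; apply: psd_congr; apply: psd_congr.
exact: posdef_psd posdef_invR.
Qed.

(** The exact second-order Taylor expansion at P. It serves both to compare two solutions and to
    correct an approximate one. *)
Lemma ricc_add P X : X^T = X ->
  ricc (P + X) = ricc P + ((cloop P)^T *m X + X *m cloop P) + X *m gain *m X.
Proof.
move=> Xs; rewrite /ricc /cloop /gain.
have -> : (P + X) *m B + S = (P *m B + S) + X *m B by rewrite mulmxDl addrAC.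
set T := P *m B + S; clearbody T.
rewrite !(trmxD, trmxN, trmx_mul, trmxK) Xs invR_sym.
rewrite !(mulmxDl, mulmxDr, mulmxN, mulNmx, mulmxA).
by apply/matrixP => i j; rewrite !(addmxE, oppmxE); ring.
Qed.

Lemma cloop_add P X : X^T = X -> cloop (P + X) = cloop P + gain *m X.
Proof.
move=> Xs; rewrite /cloop /gain.
have -> : (P + X) *m B + S = (P *m B + S) + X *m B by rewrite mulmxDl addrAC.
set T := P *m B + S; clearbody T.
rewrite !(trmxD, trmx_mul) Xs.
rewrite !(mulmxDl, mulmxDr, mulmxN, mulNmx, mulmxA).
by apply/matrixP => i j; rewrite !(addmxE, oppmxE); ring.
Qed.

Lemma ricc_diff P1 P2 : P1^T = P1 -> P2^T = P2 -> ricc P1 = 0 -> ricc P2 = 0 ->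
  (cloop P1)^T *m (P1 - P2) + (P1 - P2) *m cloop P1
  = (P1 - P2) *m gain *m (P1 - P2).
Proof.
move=> s1 s2 r1 r2.
have Xs : (P2 - P1)^T = P2 - P1 by rewrite trmxD trmxN s1 s2.
have := ricc_add P1 Xs; rewrite subrKC r1 r2 add0r.
rewrite -(opprB P2 P1) => /esym/eqP; rewrite addr_eq0 => /eqP e.
by rewrite !mulmxN !mulNmx opprK -opprD e opprK.
Qed.

(** The right-hand side of [ricc_diff] is semidefinite, so [lyap_psd] for the transposed closed loop
    applies to P1 - P2. Maximality then yields uniqueness by antisymmetry. *)
Lemma lyap_ricc_max P1 P2 : P1^T = P1 -> P2^T = P2 -> ricc P1 = 0 -> ricc P2 = 0 ->
  lyap (cloop P1) -> possemidef (P1 - P2).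
Proof.
move=> s1 s2 r1 r2 /lyap_tr h1.
have Xs : (P1 - P2)^T = P1 - P2 by rewrite trmxD trmxN s1 s2.
by apply: lyap_psd h1 (Xs) _; rewrite trmxK (ricc_diff s1 s2 r1 r2); exact: psd_gain.
Qed.

Lemma lyap_ricc_min P1 P2 : P1^T = P1 -> P2^T = P2 -> ricc P1 = 0 -> ricc P2 = 0 ->
  lyap (- cloop P1) -> possemidef (P2 - P1).
Proof.
move=> s1 s2 r1 r2 /lyap_tr h1.
have Xs : (P1 - P2)^T = P1 - P2 by rewrite trmxD trmxN s1 s2.
have Ys : (P2 - P1)^T = P2 - P1 by rewrite trmxD trmxN s1 s2.
apply: lyap_psd h1 (Ys) _; rewrite trmxK trmxN -(opprB P1 P2) !mulmxN !mulNmx !opprK.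
by rewrite (ricc_diff s1 s2 r1 r2); exact: psd_gain.
Qed.

Lemma lyap_ricc_uniq P1 P2 : P1^T = P1 -> P2^T = P2 -> ricc P1 = 0 -> ricc P2 = 0 ->
  lyap (cloop P1) -> lyap (cloop P2) -> P1 = P2.
Proof.
move=> s1 s2 r1 r2 h1 h2; apply/eqP; rewrite -subr_eq0; apply/eqP.
by apply: psd_antisym; rewrite ?opprB; exact: lyap_ricc_max.
Qed.

Lemma lyapN_ricc_uniq P1 P2 : P1^T = P1 -> P2^T = P2 -> ricc P1 = 0 -> ricc P2 = 0 ->
  lyap (- cloop P1) -> lyap (- cloop P2) -> P1 = P2.
Proof.
move=> s1 s2 r1 r2 h1 h2; apply/eqP; rewrite -subr_eq0; apply/eqP.
by apply: psd_antisym; rewrite ?opprB; exact: lyap_ricc_min.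
Qed.

(* The reflected closed loop is - W (cloop P)^T W^-1, with W the controllability Gramian. *)
Lemma ricc_reflection P : controllable A B ->
  P^T = P -> ricc P = 0 -> lyap (cloop P) ->
  exists D, [/\ posdef D, ricc (P - D) = 0 & lyap (- cloop (P - D))].
Proof.
move=> AB Ps r0 hP; have Gp := posdef_invR.
have Gs : gain^T = gain by rewrite /gain !trmx_mul trmxK Gp.1 mulmxA.
have [f hf] := lyap_solve hP; have [Ws WE] := hf _ Gs; move: (f gain) Ws WE => W Ws WE.
have Wp : posdef W.
  apply: (@controllable_gramian _ _ _ A B AB (invmx R *m (P *m B + S)^T) _ _ Gp).
    apply: lyap_psd hP Ws _; rewrite WE /gain; apply: psd_congr; exact: posdef_psd.
  by rewrite mulmxA -/(cloop P) WE.
have Wu := posdef_unit Wp; have Dp := posdef_inv Wp; set D := invmx W.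
have Ds : (- D)^T = - D by rewrite trmxN Dp.1.
have DW : D *m W = 1%:M by rewrite mulVmx.
have WD : W *m D = 1%:M by rewrite mulmxV.
have cE : cloop (P - D) *m W = - (W *m (cloop P)^T).
  rewrite cloop_add // mulmxDl mulmxN mulNmx -mulmxA DW mulmx1 -WE.
  by apply/matrixP => i j; rewrite !(addmxE, oppmxE); ring.
exists D; split => //.
  have e : D *m gain *m D = D *m cloop P + (cloop P)^T *m D.
    by rewrite -WE mulmxDr mulmxDl !mulmxA DW mul1mx -!mulmxA WD mulmx1.
  rewrite ricc_add // r0 add0r !(mulmxN, mulNmx) opprK e.
  by rewrite -opprD [X in - X]addrC addNr.
have [Y [Yp Zp]] := lyap_tr hP; rewrite trmxK in Zp.
have congW M : posdef M -> posdef (W *m M *m W).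
  move=> Mp; split; first by rewrite !trmx_mul Ws Mp.1 mulmxA.
  move=> x x0; rewrite qform_bform -mulmxA bformMm Ws bformM; apply: Mp.2.
  by apply: contra x0 => /eqP e; rewrite -(mulKmx Wu x) e mulmx0.
(* By [cE], W conjugates the transpose of [cloop P] into [- cloop (P - D)], which carries a
   certificate Y of the transpose to W Y W. *)
exists (W *m Y *m W); split; first exact: congW.
have -> : - cloop (P - D) *m (W *m Y *m W) + W *m Y *m W *m (- cloop (P - D))^T
   = W *m ((cloop P)^T *m Y + Y *m cloop P) *m W; last exact: congW.
have -> : W *m Y *m W *m (- cloop (P - D))^T = W *m Y *m (- (cloop (P - D) *m W))^T.
  by rewrite -mulNmx trmx_mul Ws !mulmxA.
rewrite mulNmx !mulmxA cE opprK trmx_mul trmxK Ws !mulNmx opprK.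
by rewrite mulmxDr mulmxDl !mulmxA.
Qed.

(** Completing the square: the left side is the form of R at u + R^-1 (P B + S)^T x. The inequality
    is linear in P and free of R^-1, so it can be rescaled and passed to the limit. *)
Lemma ricc_lmi P x u : P^T = P -> ricc P = 0 ->
  2 * bform P x (A *m x + B *m u) + bform Q x x + 2 * bform S x u + bform R u u <= 0.
Proof.
move=> Ps r0; have Ru : R \in unitmx.
  by have := posdef_unit (posdef_opp Rn); rewrite -scaleN1r unitmxZ ?unitrN1.
set T := P *m B + S; set v := invmx R *m T^T *m x.
suff -> : 2 * bform P x (A *m x + B *m u) + bform Q x x + 2 * bform S x u + bform R u u
   = bform R (u + v) (u + v).
  have [->|uv0] := eqVneq (u + v) 0; first by rewrite bform0.
  exact/ltW/Rn.2.
have Rv : R *m v = T^T *m x by rewrite /v -mulmxA mulKVmx.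
have e : bform (A^T *m P + P *m A + Q) x x = bform R v v.
  have := congr1 (fun M => bform M x x) r0.
  rewrite bform0l /ricc -/T bformDl bformNl => /eqP; rewrite subr_eq0 => /eqP ->.
  rewrite -mulmxA bformMm bformM /v -mulmxA; move: (T^T *m x) => y.
  by rewrite -[RHS]bformM mulmxV // bformC ?trmx1 // -bformM mul1mx.
move: e; rewrite !bformDl bformMm trmxK bformM => e.
rewrite !(bformD, bformDm).
have -> : bform R v u = bform R u v by rewrite bformC // Rn.1.
have -> : bform R u v = bform T x u.
  by rewrite -[bform R u v]/((u^T *m R *m v) 0 0) -mulmxA Rv mulmxA -/(bform _ _ _) bformtr.
rewrite -e /T bformDl bformM [bform P (A *m x) x]bformC //; ring.
Qed.
End RiccatiEquation.

(** * Determinants of positive definite matrices *)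

Lemma char_poly_horner (K : comNzRingType) n (M : 'M[K]_n) s :
  (char_poly M).[s] = \det (s%:M - M).
Proof.
rewrite /char_poly -[LHS]/(horner_eval s _) -det_map_mx; congr (\det _).
apply/matrixP => i j; rewrite !mxE /= /horner_eval hornerD hornerN hornerC.
by rewrite hornerMn hornerX.
Qed.

(* det (s + M) has no root s >= 0 and is positive for large s. *)
Lemma posdef_det_gt0 (K : realType) n (M : 'M[K]_n) : posdef M -> 0 < \det M.
Proof.
move=> Mp; pose p := char_poly (- M).
have pE s : p.[s] = \det (s%:M + M) by rewrite char_poly_horner opprK.
have p0 s : 0 <= s -> p.[s] != 0.
  move=> s0; rewrite pE -unitfE -unitmxE addrC; apply: posdef_unit.
  apply: posdefD => //; rewrite -scalemx1; apply: psdZ => //; exact: psd1.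
have lp : lead_coef p = 1 by apply/monicP; exact: char_poly_monic.
have [|N hN] := @poly_pinfty_gt_lc _ p; first by rewrite lp.
set b := Num.max N 0; have b0 : 0 <= b by rewrite le_max lexx orbT.
have pb : 0 < p.[b].
  by apply: lt_le_trans (hN b _); rewrite ?lp // le_max lexx.
rewrite ltNge; apply/negP => d0.
have p00 : p.[0] < 0 by rewrite lt_neqAle p0 // pE raddf0 add0r.
have [|x] := @poly_ivtoo _ p 0 b b0; first by rewrite nmulr_rlt0.
rewrite in_itv /= => /andP[x0 _]; rewrite rootE; apply/negP/p0; exact: ltW.
Qed.

(** * Entrywise convergence of matrices along a filter *)

Definition mcvg (K : realType) (I : Type) (F : set_system I) a b
    (f : I -> 'M[K]_(a, b)) (M : 'M[K]_(a, b)) : Prop :=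
  forall i j, (fun k => f k i j) @ F --> M i j.

Lemma cvg_mcvg (K : realType) (I : Type) (F : set_system I) {FF : Filter F} a b
  (f : I -> 'M[K]_(a, b)) M : f @ F --> M -> mcvg F f M.
Proof.
move=> h i j V hV; apply: (h [set X : 'M[K]_(a, b) | V (X i j)]).
exists (fun i' j' => if (i' == i) && (j' == j) then V else setT) => /=.
  by move=> i' j'; case: ifP => [/andP[/eqP -> /eqP ->] //|_]; exact: filterT.
by move=> X /(_ i j); rewrite !eqxx.
Qed.

Section MCvg.
Variables (K : realType) (I : Type) (F : set_system I).
Context {FF : Filter F}.

Lemma cvg_sumr (J : Type) (r : seq J) (P : pred J) (f : J -> I -> K) (l : J -> K) :
  (forall j, f j @ F --> l j) ->
  (fun k => \sum_(j <- r | P j) f j k) @ F --> \sum_(j <- r | P j) l j.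
Proof.
by move=> h; apply: cvg_big => //; exact: add_continuous.
Qed.

Lemma cvg_prodr (J : Type) (r : seq J) (P : pred J) (f : J -> I -> K) (l : J -> K) :
  (forall j, f j @ F --> l j) ->
  (fun k => \prod_(j <- r | P j) f j k) @ F --> \prod_(j <- r | P j) l j.
Proof.
by move=> h; apply: cvg_big => //; exact: mul_continuous.
Qed.

Lemma mcvg_cst a b (M : 'M[K]_(a, b)) : mcvg F (fun=> M) M.
Proof. by move=> i j; exact: cvg_cst. Qed.

Lemma mcvgD a b (f g : I -> 'M[K]_(a, b)) M N :
  mcvg F f M -> mcvg F g N -> mcvg F (fun k => f k + g k) (M + N).
Proof.
move=> hf hg i j; rewrite mxE; under eq_cvg do rewrite mxE; exact: cvgD.
Qed.

Lemma mcvgN a b (f : I -> 'M[K]_(a, b)) M : mcvg F f M -> mcvg F (fun k => - f k) (- M).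
Proof.
move=> hf i j; rewrite mxE; under eq_cvg do rewrite mxE; exact: cvgN.
Qed.

Lemma mcvgB a b (f g : I -> 'M[K]_(a, b)) M N :
  mcvg F f M -> mcvg F g N -> mcvg F (fun k => f k - g k) (M - N).
Proof. by move=> hf hg; apply: mcvgD => //; exact: mcvgN. Qed.

Lemma mcvgM a b c (f : I -> 'M[K]_(a, b)) (g : I -> 'M[K]_(b, c)) M N :
  mcvg F f M -> mcvg F g N -> mcvg F (fun k => f k *m g k) (M *m N).
Proof.
move=> hf hg i j; rewrite mxE; under eq_cvg do rewrite mxE.
by apply: cvg_sumr => l; apply: cvgM.
Qed.

Lemma mcvgZ a b (s : I -> K) (f : I -> 'M[K]_(a, b)) (t : K) M :
  s @ F --> t -> mcvg F f M -> mcvg F (fun k => s k *: f k) (t *: M).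
Proof.
move=> hs hf i j; rewrite mxE; under eq_cvg do rewrite mxE; exact: cvgM.
Qed.

Lemma mcvg_tr a b (f : I -> 'M[K]_(a, b)) M :
  mcvg F f M -> mcvg F (fun k => (f k)^T) M^T.
Proof. by move=> hf i j; rewrite mxE; under eq_cvg do rewrite mxE; exact: hf. Qed.

Lemma mcvg_bform a b (f : I -> 'M[K]_(a, b)) M x y :
  mcvg F f M -> (fun k => bform (f k) x y) @ F --> bform M x y.
Proof. by move=> hf; apply: mcvgM => //; [apply: mcvgM => //|]; exact: mcvg_cst. Qed.

Lemma mcvg_det a (f : I -> 'M[K]_a) M :
  mcvg F f M -> (fun k => \det (f k)) @ F --> \det M.
Proof.
move=> hf; apply: cvg_sumr => s; apply: cvgM; first exact: cvg_cst.
by apply: cvg_prodr => i; exact: hf.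
Qed.

Lemma mcvg_trace a (f : I -> 'M[K]_a) M :
  mcvg F f M -> (fun k => \tr (f k)) @ F --> \tr M.
Proof. by move=> hf; apply: cvg_sumr => i; exact: hf. Qed.

Lemma mcvg_abssum a b (f : I -> 'M[K]_(a, b)) M :
  mcvg F f M -> (fun k => abssum (f k)) @ F --> abssum M.
Proof.
by move=> hf; apply: cvg_sumr => i; apply: cvg_sumr => j; apply: cvg_norm.
Qed.

Lemma mcvg_near a b (f g : I -> 'M[K]_(a, b)) M :
  (\forall k \near F, f k = g k) -> mcvg F f M -> mcvg F g M.
Proof.
move=> fg hf i j; apply: cvg_trans (hf i j); apply: near_eq_cvg.
by apply: filterS fg => k /= ->.
Qed.

Lemma mcvg_inv a (f : I -> 'M[K]_a) M :
  M \in unitmx -> mcvg F f M -> mcvg F (fun k => invmx (f k)) (invmx M).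
Proof.
move=> Mu hf; have d0 : \det M != 0 by rewrite -unitfE -unitmxE.
have hd := mcvg_det hf.
have -> : invmx M = (\det M)^-1 *: \adj M by rewrite /invmx Mu.
(* The adjugate formula agrees with [invmx] only where the determinant is nonzero, which holds
   eventually because its limit is nonzero. *)
apply: (@mcvg_near _ _ (fun k => (\det (f k))^-1 *: \adj (f k))).
  by apply: filterS (cvgr_neq0 _ hd d0) => k; rewrite -unitfE -unitmxE /invmx => ->.
apply: mcvgZ; first exact: cvgV.
move=> i j; rewrite mxE; under eq_cvg do rewrite mxE.
apply: cvgM; first exact: cvg_cst.
by apply: mcvg_det => k l; rewrite !mxE; under eq_cvg do rewrite !mxE; exact: hf.
Qed.

Lemma mcvg_affine p a b (H : 'I_p.+1 -> 'M[K]_(a, b)) (f : I -> 'cV[K]_p) l :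
  mcvg F f l -> mcvg F (fun k => affine H (f k)) (affine H l).
Proof.
move=> hf; apply: mcvgD; first exact: mcvg_cst.
move=> i j; rewrite summxE; under eq_cvg do rewrite summxE.
apply: (cvg_sumr (f := fun k x => (f x k 0 *: H (lift ord0 k)) i j)) => k.
have := mcvgZ (hf k 0) (@mcvg_cst _ _ (H (lift ord0 k))).
by apply.
Qed.
End MCvg.

Section MCvgProper.
Variables (K : realType) (I : Type) (F : set_system I).
Context {FF : ProperFilter F}.

Lemma cvg_limit_ge (f : I -> K) (l a : K) :
  f @ F --> l -> (\forall k \near F, a <= f k) -> a <= l.
Proof.
move=> h ge; rewrite -(cvg_lim (@norm_hausdorff _ _) h); apply: limr_ge => //.
by apply/cvg_ex; exists l.
Qed.

Lemma cvg_limit_le (f : I -> K) (l a : K) :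
  f @ F --> l -> (\forall k \near F, f k <= a) -> l <= a.
Proof.
move=> h le; rewrite -(cvg_lim (@norm_hausdorff _ _) h); apply: limr_le => //.
by apply/cvg_ex; exists l.
Qed.

Lemma mcvg_unique a b (f : I -> 'M[K]_(a, b)) M N : mcvg F f M -> mcvg F f N -> M = N.
Proof.
move=> hM hN; apply/matrixP => i j.
exact: (cvg_unique (@norm_hausdorff _ _) (hM i j) (hN i j)).
Qed.

Lemma mcvg_psd a (f : I -> 'M[K]_a) M :
  (forall k, possemidef (f k)) -> mcvg F f M -> possemidef M.
Proof.
move=> fp hf; split.
  apply: mcvg_unique (mcvg_tr hf) _.
  by apply: mcvg_near hf; apply: nearW => k; rewrite (fp k).1.
move=> x; rewrite qform_bform.
have h : (fun k => bform (f k) x x) @ F --> bform M x x by exact: mcvg_bform.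
apply: (cvg_limit_ge h).
by apply: nearW => k; exact: psdE.
Qed.
End MCvgProper.

(** * Ultrafilter limits and boundedness of Riccati solutions *)

Section Ultra.
Variables (K : realType) (I : Type) (U : set_system I).
Context {UU : UltraFilter U}.

Lemma ultra_bounded_cvg (f : I -> K) (M : K) :
  U [set k | `|f k| <= M] -> exists l : K, f @ U --> l.
Proof.
move=> hM; have UP := @ultra_proper _ U UU; pose G := f @ U.
have GM : G `[- M, M]%classic; first rewrite /G /fmap /=.
  apply: filterS hM => k; rewrite /= ler_norml => /andP[h1 h2].
  by rewrite in_itv /= h1.
have [l [_ cl]] := segment_compact _ GM.
(* A cluster point of an ultrafilter is a limit: otherwise the complement of V would belong to the
   filter and meet V. *)
exists l => V hV; have [//|hc] := in_ultra_setVsetC (f @^-1` V) UU.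
have [x []] := cl (~` V) V hc hV.
by [].
Qed.

Lemma ultra_mcvg a b (f : I -> 'M[K]_(a, b)) M :
  U [set k | abssum (f k) <= M] -> exists L, mcvg U f L.
Proof.
move=> hM; have UP := @ultra_proper _ U UU.
have h i j : exists l : K, (fun k => f k i j) @ U --> l.
  apply: (@ultra_bounded_cvg _ M); apply: filterS hM => k /=.
  exact: le_trans (abssum_ge _ _ _).
exists (\matrix_(i, j) sval (cid (h i j))) => i j; rewrite mxE.
by case: cid.
Qed.
End Ultra.

(** An affine function of u bounded above is constant, so Pi B = 0. At u = 0 the matrix A^T Pi + Pi
    A is negative semidefinite; its form vanishes on the kernel of Pi, which is therefore invariant
    under A and contains every A^j B u. *)
Lemma lyap_nonpos_controllable0 (K : realType) n m (A : 'M[K]_n) (B : 'M[K]_(n, m)) (Pi : 'M[K]_n) :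
  controllable A B -> Pi^T = Pi ->
  (forall x u, bform Pi x (A *m x + B *m u) <= 0) -> Pi = 0.
Proof.
move=> AB Ps h.
have PB : Pi *m B = 0.
  apply: bform_inj => x u; rewrite bform0l bformM.
  apply/eqP; apply: contraT => b0.
  (* The multiple of u is chosen to make the form equal to 1. *)
  have := h x (((1 - bform Pi x (A *m x)) / bform Pi x (B *m u)) *: u).
  rewrite bformD -scalemxAr bformZ divfK // addrC subrK.
  by rewrite ler10.
pose M := A^T *m Pi + Pi *m A.
have Mp : possemidef (- M).
  split; first by rewrite trmxN trmxD !trmx_mul trmxK Ps addrC.
  move=> x; rewrite qform_bform bformNl /M bformDl bformMm trmxK bformM.
  have := h x 0; rewrite mulmx0 addr0 [bform Pi (A *m x) x]bformC //; lra.
apply: (controllable_left_kernel AB) => j.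
suff st (u : 'cV[K]_m) : Pi *m (A ^+ j *m B *m u) = 0.
  by apply: bform_inj => x u; rewrite bform0l bformM /bform -mulmxA st mulmx0 mxE.
elim: j u => [|j IH] u; first by rewrite expr0 mul1mx mulmxA PB mul0mx.
rewrite exprS -!mulmxA; move: (IH u); rewrite -!mulmxA; move: (A ^+ j *m (B *m u)) => y Py.
have My : - M *m y = 0.
  apply: psd_kernel => //; rewrite bformNl /M bformDl bformMm trmxK bformM.
  have -> : bform Pi (A *m y) y = 0 by rewrite /bform -mulmxA Py mulmx0 mxE.
  by rewrite bformC // /bform -mulmxA Py mulmx0 mxE addr0 oppr0.
have : M *m y = 0 by apply/eqP; rewrite -oppr_eq0 -mulNmx My.
by rewrite /M mulmxDl -!mulmxA Py mulmx0 add0r.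
Qed.

Section Boundedness.
Variables (K : realType) (n m : nat) (A : 'M[K]_n) (B : 'M[K]_(n, m)).
Variables (I : Type) (U : set_system I).
Context {UU : UltraFilter U}.

(* If P_k were unbounded, the normalized matrices P_k / (1 + |P_k|) would have a limit that
   satisfies the homogeneous matrix inequality, hence vanishes by controllability. *)
Lemma ricc_bounded (Q P : I -> 'M[K]_n) (S : I -> 'M[K]_(n, m)) (R : I -> 'M[K]_m) Q0 S0 R0 :
  controllable A B -> mcvg U Q Q0 -> mcvg U S S0 -> mcvg U R R0 ->
  (forall k, negdef (R k)) -> (forall k, (P k)^T = P k) ->
  (forall k, ricc A B (Q k) (S k) (R k) (P k) = 0) ->
  exists M, U [set k | abssum (P k) <= M].
Proof.
move=> AB hQ hS hR Rn Ps r0; have UP := @ultra_proper _ U UU.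
apply: contrapT => unb.
have big M : U [set k | M < abssum (P k)].
  have [h|h] := in_ultra_setVsetC [set k | abssum (P k) <= M] UU.
    by exfalso; apply: unb; exists M.
  by apply: filterS h => k /= /negP; rewrite -ltNge.
pose s k := (1 + abssum (P k))^-1.
have d0 k : 0 < 1 + abssum (P k) by have := abssum_ge0 (P k); lra.
have s0 k : 0 < s k by rewrite invr_gt0.
have scvg : s @ U --> (0 : K).
  apply/cvgrPdist_le => e e0; near=> k.
  rewrite sub0r normrN gtr0_norm // /s invf_ple ?posrE // .
  have : e^-1 < abssum (P k) by near: k; exact: big.
  by lra.
have PiE k : abssum (s k *: P k) = 1 - s k.
  have -> : abssum (s k *: P k) = s k * abssum (P k).
    rewrite /abssum mulr_sumr; apply: eq_bigr => i _; rewrite mulr_sumr.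
    by apply: eq_bigr => j _; rewrite mxE normrM gtr0_norm.
  by rewrite /s; field; rewrite gt_eqF.
have [|Pi hPi] := @ultra_mcvg K I U UU _ _ (fun k => s k *: P k) 1.
  by apply: filterE => k /=; rewrite PiE; have := s0 k; lra.
(* The normalized matrices have norm 1 - s k with s k tending to 0; this is what keeps their limit
   from being zero. *)
have Pi1 : abssum Pi = 1.
  apply: (cvg_unique (@norm_hausdorff _ _) (mcvg_abssum hPi)).
  have -> : (fun k => abssum (s k *: P k)) = (fun k => 1 - s k) by apply/funext => k.
  have h : (fun k => 1 - s k) @ U --> (1 - 0 : K) by apply: cvgB => //; exact: cvg_cst.
  by rewrite subr0 in h.
have Pis : Pi^T = Pi.
  apply: mcvg_unique (mcvg_tr hPi) _.
  by apply: mcvg_near hPi; apply: nearW => k; rewrite trmxZ Ps.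
have Pi0 : Pi = 0.
  apply: (lyap_nonpos_controllable0 AB Pis) => x u.
  have c1 : (fun k => bform (s k *: P k) x (A *m x + B *m u)) @ U --> bform Pi x (A *m x + B *m u).
    exact: mcvg_bform.
  have c2 : (fun k => s k * (bform (Q k) x x + 2 * bform (S k) x u + bform (R k) u u)) @ U
     --> 0 * (bform Q0 x x + 2 * bform S0 x u + bform R0 u u).
    apply: cvgM => //; apply: cvgD; last exact: mcvg_bform.
    apply: cvgD; first exact: mcvg_bform.
    by apply: cvgM; [exact: cvg_cst|exact: mcvg_bform].
  (* This is s k times the left side of [ricc_lmi]; the data Q, S, R converge, so their contribution
     vanishes in the limit. *)
  pose w k := 2 * bform (s k *: P k) x (A *m x + B *m u)
    + s k * (bform (Q k) x x + 2 * bform (S k) x u + bform (R k) u u).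
  have c3 : w @ U --> 2 * bform Pi x (A *m x + B *m u)
     + 0 * (bform Q0 x x + 2 * bform S0 x u + bform R0 u u).
    by apply: cvgD => //; apply: cvgM => //; exact: cvg_cst.
  have : 2 * bform Pi x (A *m x + B *m u) + 0 * (bform Q0 x x + 2 * bform S0 x u + bform R0 u u) <= 0.
    apply: (cvg_limit_le c3); apply: nearW => k; rewrite /w.
    have := ricc_lmi (Rn k) x u (Ps k) (r0 k).
    set q1 := bform (P k) _ _; rewrite bformZl -/q1.
    set q2 := bform (Q k) _ _; set q3 := bform (S k) _ _; set q4 := bform (R k) _ _ => h.
    have -> : 2 * (s k * q1) + s k * (q2 + 2 * q3 + q4)
        = s k * (2 * q1 + q2 + 2 * q3 + q4) by ring.
    by rewrite pmulr_rle0.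
  lra.
move: Pi1; rewrite Pi0 /abssum big1 => [/eqP|i _]; first by rewrite eq_sym oner_eq0.
by rewrite big1 // => j _; rewrite mxE normr0.
Unshelve. all: by end_near. Qed.
End Boundedness.

(** * Submultiplicative norm and fixed points *)

Section Abssum.
Variable K : realType.

Lemma abssumD a b (M N : 'M[K]_(a, b)) : abssum (M + N) <= abssum M + abssum N.
Proof.
rewrite /abssum -big_split; apply: ler_sum => i _; rewrite -big_split.
by apply: ler_sum => j _; rewrite mxE ler_normD.
Qed.

Lemma abssumN a b (M : 'M[K]_(a, b)) : abssum (- M) = abssum M.
Proof. by apply: eq_bigr => i _; apply: eq_bigr => j _; rewrite mxE normrN. Qed.

Lemma abssumZ a b t (M : 'M[K]_(a, b)) : abssum (t *: M) = `|t| * abssum M.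
Proof.
rewrite /abssum mulr_sumr; apply: eq_bigr => i _; rewrite mulr_sumr.
by apply: eq_bigr => j _; rewrite mxE normrM.
Qed.

Lemma abssum_tr a b (M : 'M[K]_(a, b)) : abssum M^T = abssum M.
Proof.
by rewrite /abssum exchange_big; apply: eq_bigr => i _; apply: eq_bigr => j _; rewrite mxE.
Qed.

Lemma abssum0 a b : abssum (0 : 'M[K]_(a, b)) = 0.
Proof. by rewrite /abssum big1 // => i _; rewrite big1 // => j _; rewrite mxE normr0. Qed.

Lemma abssum_sum a b (J : Type) (r : seq J) (f : J -> 'M[K]_(a, b)) :
  abssum (\sum_(j <- r) f j) <= \sum_(j <- r) abssum (f j).
Proof.
elim/big_ind2: _ => [|M x N y hM hN|//]; first by rewrite abssum0.
exact: le_trans (abssumD _ _) (lerD hM hN).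
Qed.

Lemma abssumM a b c (M : 'M[K]_(a, b)) (N : 'M[K]_(b, c)) :
  abssum (M *m N) <= abssum M * abssum N.
Proof.
rewrite {1 2}/abssum mulr_suml; apply: ler_sum => i _; rewrite mulr_suml.
apply: (@le_trans _ _ (\sum_k \sum_l `|M i l| * `|N l k|)).
  apply: ler_sum => k _; rewrite mxE; apply: le_trans (ler_norm_sum _ _ _) _.
  by apply: ler_sum => l _; rewrite normrM.
rewrite exchange_big /=; apply: ler_sum => l _; rewrite -mulr_sumr.
apply: ler_wpM2l => //; rewrite /abssum [X in _ <= X](bigD1 l) //= lerDl.
by apply: sumr_ge0 => j _; apply: sumr_ge0.
Qed.

Lemma abssum_linear a b c d (f : {linear 'M[K]_(a, b) -> 'M[K]_(c, d)}) :
  exists2 C, 0 <= C & forall G, abssum (f G) <= C * abssum G.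
Proof.
exists (\sum_i \sum_j abssum (f (delta_mx i j))).
  by apply: sumr_ge0 => i _; apply: sumr_ge0 => j _; exact: abssum_ge0.
move=> G; rewrite {1}[G]matrix_sum_delta linear_sum /= mulr_suml.
apply: le_trans (abssum_sum _ _) _; apply: ler_sum => i _.
rewrite linear_sum /= mulr_suml; apply: le_trans (abssum_sum _ _) _; apply: ler_sum => j _.
rewrite linearZ /= abssumZ mulrC; apply: ler_wpM2l; [exact: abssum_ge0|exact: abssum_ge].
Qed.

Lemma norm_le_abssum a b (M : 'M[K]_(a, b)) : `|M| <= abssum M.
Proof.
rewrite [X in X <= _]/Num.norm /= mx_normrE; apply/bigmax_leP; split; first exact: abssum_ge0.
by move=> ij _; exact: abssum_ge.
Qed.

Lemma abssum_le_norm a b (M : 'M[K]_(a, b)) : abssum M <= (a * b)%:R * `|M|.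
Proof.
have h i j : `|M i j| <= `|M|.
  rewrite [X in _ <= X]/Num.norm /= mx_normrE.
  exact: (le_bigmax _ (fun ij : 'I_a * 'I_b => `|M ij.1 ij.2|) (i, j)).
apply: (@le_trans _ _ (\sum_(i < a) \sum_(j < b) `|M|)).
  by apply: ler_sum => i _; apply: ler_sum => j _; exact: h.
by rewrite !sumr_const !card_ord -mulrnA mulnC mulr_natl.
Qed.
End Abssum.

HB.instance Definition _ (K : realType) a b :=
  Uniform_isComplete.Build 'M[K]_(a, b) cauchy_cvg.

Lemma closed_ball_fixed_point (K : realType) (V : completeNormedModType K) (T : V -> V)
    (rho q : K) :
  0 < rho -> 0 <= q < 1 -> (forall X, `|X| <= rho -> `|T X| <= rho) ->
  (forall X Y, `|X| <= rho -> `|Y| <= rho -> `|T X - T Y| <= q * `|X - Y|) ->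
  exists2 X, `|X| <= rho & X = T X.
Proof.
move=> rho0 /andP[q0 q1] hT hq; pose U := closed_ball (0 : V) rho.
have UE X : U X = (`|X| <= rho) :> Prop.
  by rewrite /U closed_ballE // /closed_ball_ /= sub0r normrN.
have TU : {homo T : x / U x >-> U x} by move=> X; rewrite !UE; exact: hT.
have [|||X UX XT] := @banach_fixed_point K V U (mkfun_fun TU).
- exists (NngNum q0); split => // -[X Y] [/=]; rewrite !UE; exact: hq.
- exact: closed_ball_closed.
- by exists 0; rewrite UE normr0 ltW.
by exists X; rewrite -?UE.
Qed.

(** * Solvability of a perturbed Riccati equation *)

Section Perturbation.
Variables (K : realType) (n : nat).
Implicit Types (E D G X Y : 'M[K]_n).

(** Lets the iteration run on the normed space of all matrices, while the Lyapunov inverse is only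
    specified on symmetric ones. *)
Definition sympart X : 'M[K]_n := 2^-1 *: (X + X^T).

Lemma sympart_sym X : (sympart X)^T = sympart X.
Proof. by rewrite /sympart trmxZ trmxD trmxK addrC. Qed.

Lemma sympartB X Y : sympart (X - Y) = sympart X - sympart Y.
Proof.
rewrite /sympart -scalerBr trmxD trmxN; congr (_ *: _).
by apply/matrixP => i j; rewrite !(addmxE, oppmxE); ring.
Qed.

Lemma abssum_sympart X : abssum (sympart X) <= abssum X.
Proof.
rewrite /sympart abssumZ ger0_norm ?invr_ge0 //.
have := abssumD X X^T; rewrite abssum_tr; lra.
Qed.

(** In the application E is the residual of the old solution at the new parameter, D the change of
    its closed loop, G the new gain and X the correction sought. *)
Definition ricc_pert E D G X : 'M[K]_n := E + (D^T *m X + X *m D) + X *m G *m X.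

Lemma ricc_pert_sym E D G X : E^T = E -> G^T = G -> X^T = X ->
  (ricc_pert E D G X)^T = ricc_pert E D G X.
Proof.
move=> Es Gs Xs; rewrite /ricc_pert !(trmxD, trmx_mul, trmxK) Es Gs Xs mulmxA.
by apply/matrixP => i j; rewrite !(addmxE, oppmxE); ring.
Qed.

Lemma abssum_ricc_pert E D G X : abssum (ricc_pert E D G X) <=
  abssum E + 2 * abssum D * abssum X + abssum G * abssum X ^+ 2.
Proof.
rewrite /ricc_pert.
have h1 := abssumD (E + (D^T *m X + X *m D)) (X *m G *m X).
have h2 := abssumD E (D^T *m X + X *m D).
have h3 := abssumD (D^T *m X) (X *m D).
have h4 := abssumM D^T X; have h5 := abssumM X D; rewrite abssum_tr in h4.
have h6 := abssumM (X *m G) X.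
have h7 := ler_wpM2r (abssum_ge0 X) (abssumM X G).
lra.
Qed.

Lemma abssum_ricc_pertB E D G X Y : abssum (ricc_pert E D G X - ricc_pert E D G Y) <=
  (2 * abssum D + abssum G * (abssum X + abssum Y)) * abssum (X - Y).
Proof.
have -> : ricc_pert E D G X - ricc_pert E D G Y =
    (D^T *m (X - Y) + (X - Y) *m D) + ((X - Y) *m G *m X + Y *m G *m (X - Y)).
  rewrite /ricc_pert !(mulmxDr, mulmxDl, mulmxN, mulNmx).
  by apply/matrixP => i j; rewrite !(addmxE, oppmxE); ring.
set Z := X - Y.
have h2 := abssumD (D^T *m Z + Z *m D) (Z *m G *m X + Y *m G *m Z).
have h3 := abssumD (D^T *m Z) (Z *m D).
have h4 := abssumM D^T Z; have h5 := abssumM Z D; rewrite abssum_tr in h4.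
have h6 := abssumD (Z *m G *m X) (Y *m G *m Z).
have h7 := abssumM (Z *m G) X; have h8 := ler_wpM2r (abssum_ge0 X) (abssumM Z G).
have h9 := abssumM (Y *m G) Z; have h10 := ler_wpM2r (abssum_ge0 Z) (abssumM Y G).
lra.
Qed.

(* X is a fixed point of - f (ricc_pert E D G X), where f inverts the Lyapunov operator. *)
Lemma ricc_pert_solve (A0 : 'M[K]_n) (g eps : K) : lyap A0 -> 0 <= g -> 0 < eps ->
  exists2 delta, 0 < delta & forall E D G, E^T = E -> G^T = G ->
    abssum E <= delta -> abssum D <= delta -> abssum G <= g ->
    exists X, [/\ X^T = X, abssum X <= eps &
      (A0^T *m X + X *m A0) + ricc_pert E D G X = 0].
Proof.
move=> /lyap_tr/lyap_solve[f hf] g0 eps0; have [C C0 fC] := abssum_linear f.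
set N : K := (n * n)%:R + 1.
have N1 : 1 <= N by rewrite lerDr ler0n.
have normN X : abssum X <= N * `|X|.
  apply: le_trans (abssum_le_norm _) _; apply: ler_wpM2r => //.
  by rewrite /N lerDl.
have CgN0 : 0 <= C * g * N ^+ 2 by apply: mulr_ge0; [exact: mulr_ge0|exact: sqr_ge0].
have CN0 : 0 <= C * N by rewrite mulr_ge0 //; lra.
(* N compares [abssum] with the sup norm, and eps / N enforces the final bound on X. The second
   entries of rho and of delta below make the quadratic and the linear part each contract by 1/4;
   the self-map estimate adds up to rho (1/2 + 1/4 + 1/8). *)
set rho := Num.min (eps / N) (8 * (C * g * N ^+ 2) + 1)^-1.
have rho0 : 0 < rho.
  by rewrite /rho lt_min divr_gt0 ?invr_gt0 //; lra.
have rhoeps : N * rho <= eps.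
  by rewrite mulrC -ler_pdivlMr; [rewrite /rho ge_min lexx|lra].
have rhog : 8 * (C * g * N ^+ 2) * rho <= 1.
  have : rho * (8 * (C * g * N ^+ 2) + 1) <= 1.
    by rewrite -ler_pdivlMr; [rewrite mul1r /rho ge_min lexx orbT|lra].
  have := rho0; lra.
set delta := Num.min (rho / (2 * C + 1)) (8 * (C * N) + 1)^-1.
have delta0 : 0 < delta.
  by rewrite /delta lt_min divr_gt0 ?invr_gt0 //; lra.
have d1 : C * delta <= rho / 2.
  have : delta * (2 * C + 1) <= rho.
    by rewrite -ler_pdivlMr; [rewrite /delta ge_min lexx|lra].
  by have := delta0; lra.
have d2 : 8 * (C * N) * delta <= 1.
  have : delta * (8 * (C * N) + 1) <= 1.
    by rewrite -ler_pdivlMr; [rewrite mul1r /delta ge_min lexx orbT|lra].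
  by have := delta0; lra.
exists delta => // E D G Es Gs hE hD hG.
pose T X := - f (ricc_pert E D G (sympart X)).
have sN X : `|X| <= rho -> abssum (sympart X) <= N * rho.
  move=> hX; apply: le_trans (abssum_sympart X) _; apply: le_trans (normN X) _.
  by apply: ler_wpM2l => //; lra.
have [||X Y|X Xrho XT] := @closed_ball_fixed_point K _ T rho 2^-1 rho0.
- by lra.
- move=> X /sN hX; apply: le_trans (norm_le_abssum _) _; rewrite /T abssumN.
  apply: le_trans (fC _) _.
  have h := abssum_ricc_pert E D G (sympart X); set x := abssum (sympart X) in h hX.
  have x0 : 0 <= x by exact: abssum_ge0.
  have D0 := abssum_ge0 D; have G0 := abssum_ge0 G.
  have h1 : abssum D * x <= delta * (N * rho) by apply: ler_pM.
  have h2 : abssum G * x ^+ 2 <= g * (N * rho) ^+ 2.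
    by apply: ler_pM => //; [exact: sqr_ge0|rewrite ler_sqr ?nnegrE //; lra].
  have h3 : abssum (ricc_pert E D G (sympart X))
      <= delta + 2 * (delta * (N * rho)) + g * (N * rho) ^+ 2.
    by lra.
  apply: le_trans (ler_wpM2l C0 h3) _.
  have h4 := ler_wpM2r (ltW rho0) d2; have h5 := ler_wpM2r (ltW rho0) rhog.
  have -> : C * (delta + 2 * (delta * (N * rho)) + g * (N * rho) ^+ 2) =
    C * delta + (8 * (C * N) * delta * rho) / 4 + (8 * (C * g * N ^+ 2) * rho * rho) / 8 by field.
  lra.
- move=> /sN hX /sN hY; apply: le_trans (norm_le_abssum _) _.
  rewrite /T -opprD abssumN -linearN -linearD /=; apply: le_trans (fC _) _.
  have := abssum_ricc_pertB E D G (sympart X) (sympart Y).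
  set c := (2 * _ + _); set u := abssum (ricc_pert _ _ _ _ - _) => h.
  have hc : c <= 2 * delta + g * (N * rho + N * rho).
    have X0 := abssum_ge0 (sympart X); have Y0 := abssum_ge0 (sympart Y).
    have G0 := abssum_ge0 G.
    rewrite /c; apply: lerD; first by rewrite ler_wpM2l.
    by apply: ler_pM => //; [exact: addr_ge0|exact: lerD].
  have hz : abssum (sympart X - sympart Y) <= N * `|X - Y|.
    by rewrite -sympartB; apply: le_trans (abssum_sympart _) (normN _).
  have c0 : 0 <= c by rewrite /c addr_ge0 // mulr_ge0 ?addr_ge0 ?abssum_ge0.
  have h1 : u <= (2 * delta + g * (N * rho + N * rho)) * (N * `|X - Y|).
    by apply: le_trans h _; apply: ler_pM => //; exact: abssum_ge0.
  have h2 := ler_wpM2l C0 h1; apply: le_trans h2 _.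
  have -> : C * ((2 * delta + g * (N * rho + N * rho)) * (N * `|X - Y|))
    = (8 * (C * N) * delta / 4 + 8 * (C * g * N ^+ 2) * rho / 4) * `|X - Y| by field.
  by apply: ler_wpM2r => //; lra.
have Ps := ricc_pert_sym D Es Gs (sympart_sym X).
have [fs fE] := hf _ Ps.
(* The fixed point is symmetric since f preserves symmetry, so the symmetrization inside T can be
   removed. *)
have Xs : X^T = X by rewrite XT /T trmxN fs.
have XE : sympart X = X.
  have e2 : X + X = 2 *: X by rewrite scaler_nat mulr2n.
  by rewrite /sympart Xs e2 scalerA mulVf ?scale1r // pnatr_eq0.
exists X; split => //.
  by apply: le_trans (normN X) (le_trans _ rhoeps); apply: ler_wpM2l => //; lra.
move: fE; rewrite trmxK XE.
have -> : f (ricc_pert E D G X) = - X by rewrite {2}XT /T XE opprK.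
by rewrite mulmxN mulNmx -opprD => <-; rewrite subrr.
Qed.
End Perturbation.

(** * Openness of the feasible set *)

Lemma mcvg_id (K : realType) a b (M : 'M[K]_(a, b)) : mcvg (nbhs M) id M.
Proof. exact: cvg_mcvg. Qed.

Lemma mcvg_abssumB (K : realType) (I : Type) (F : set_system I) {FF : Filter F} a b
  (f : I -> 'M[K]_(a, b)) M e :
  mcvg F f M -> 0 < e -> \forall k \near F, abssum (f k - M) < e.
Proof.
move=> hf e0; have h : (fun k => abssum (f k - M)) @ F --> abssum (M - M).
  by apply: mcvg_abssum; apply: mcvgB => //; exact: mcvg_cst.
by rewrite subrr abssum0 in h; exact: (cvgr_lt _ h _ e0).
Qed.

Lemma mcvg_posdef (K : realType) (I : Type) (F : set_system I) {FF : Filter F} a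
  (f : I -> 'M[K]_a) M : (forall k, (f k)^T = f k) ->
  mcvg F f M -> posdef M -> \forall k \near F, posdef (f k).
Proof.
move=> fs hf /posdef_coercive[mu mu0 hmu].
have m2 : 0 < mu / 2 by rewrite divr_gt0.
apply: filterS (mcvg_abssumB hf m2) => k hk.
by apply: coercive_perturb (fs k) hmu _; lra.
Qed.

Lemma affine_sym (K : realType) p a (H : 'I_p.+1 -> 'M[K]_a) l :
  (forall i, (H i)^T = H i) -> (affine H l)^T = affine H l.
Proof.
move=> Hs; rewrite /affine trmxD Hs linear_sum /=; congr (_ + _).
by apply: eq_bigr => i _; rewrite linearZ /= Hs.
Qed.

Lemma ricc_sym (K : realType) n m (A : 'M[K]_n) (B : 'M[K]_(n, m)) Q S R P :
  Q^T = Q -> R^T = R -> P^T = P -> (ricc A B Q S R P)^T = ricc A B Q S R P.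
Proof.
move=> Qs Rs Ps; rewrite /ricc !(trmxD, trmxN, trmx_mul, trmxK) trmx_inv Qs Rs Ps !mulmxA.
by apply/matrixP => i j; rewrite !(addmxE, oppmxE); ring.
Qed.

Lemma gain_sym (K : realType) n m (B : 'M[K]_(n, m)) R : R^T = R -> (gain B R)^T = gain B R.
Proof. by move=> Rs; rewrite /gain !trmx_mul trmxK trmxN trmx_inv Rs !mulmxA. Qed.

(** The same Y remains a certificate: A Y + Y A^T moves by at most 2 kappa |Y|, which is at most a
    quarter of its coercivity constant z. *)
Lemma lyap_perturb (K : realType) n (A : 'M[K]_n) : lyap A ->
  exists2 kappa, 0 < kappa & forall A', abssum (A' - A) <= kappa -> lyap A'.
Proof.
move=> [Y [Yp Zp]]; have [z z0 hz] := posdef_coercive Zp; have Y0 := abssum_ge0 Y.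
exists (z / (8 * (abssum Y + 1))); first by rewrite divr_gt0 //; lra.
move=> A1; rewrite ler_pdivlMr => [h|]; last by lra.
exists Y; split => //; apply: coercive_perturb hz _.
  by rewrite trmxD !trmx_mul trmxK Yp.1 addrC.
have -> : A1 *m Y + Y *m A1^T - (A *m Y + Y *m A^T) = (A1 - A) *m Y + Y *m (A1 - A)^T.
  rewrite !(trmxD, trmxN, mulmxDl, mulmxDr, mulmxN, mulNmx).
  by apply/matrixP => i j; rewrite !(addmxE, oppmxE); ring.
have h1 := abssumD ((A1 - A) *m Y) (Y *m (A1 - A)^T).
have h2 := abssumM (A1 - A) Y; have h3 := abssumM Y (A1 - A)^T; rewrite abssum_tr in h3.
have d0 := abssum_ge0 (A1 - A); lra.
Qed.

Section FeasibleSet.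
Variables (K : realType) (n m p r : nat).
Variables (A : 'M[K]_n) (B : 'M[K]_(n, m)).
Variables (N : 'I_p.+1 -> 'M[K]_r) (Q : 'I_p.+1 -> 'M[K]_n)
          (S : 'I_p.+1 -> 'M[K]_(n, m)) (R : 'I_p.+1 -> 'M[K]_m).

Lemma anti_stabilizing_lyap l P : anti_stabilizing A B Q S R l P <->
  [/\ P^T = P, riccati A B Q S R P l = 0 & lyap (closed_loop A B S R P l)].
Proof.
by split=> -[Ps r0 sp]; split => //; [exact: spectrum_lyap|exact: lyap_spectrum].
Qed.

Lemma stabilizing_lyap l P : stabilizing A B Q S R l P <->
  [/\ P^T = P, riccati A B Q S R P l = 0 & lyap (- closed_loop A B S R P l)].
Proof.
have eN (M : 'M[K]_n) z : eigenvalue (map_mx (real_complex K) (- M)) z ->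
    eigenvalue (map_mx (real_complex K) M) (- z).
  move=> /eigenvalueP[v h v0]; apply/eigenvalueP; exists v => //.
  by rewrite scaleNr -h map_mxN mulmxN opprK.
have ReN (z : K[i]) : complex.Re (- z) = - complex.Re z by case: z.
split=> -[Ps r0 sp]; split => //.
  by apply: spectrum_lyap => z /eN/sp; rewrite /= ReN oppr_lt0.
move=> z hz; have := lyap_spectrum sp (z := - z); rewrite ReN oppr_gt0; apply.
by apply: eN; rewrite map_mxN; move: hz; rewrite -{1}[closed_loop _ _ _ _ _ _]opprK map_mxN.
Qed.

(** [xget] returns some anti-stabilizing solution; uniqueness identifies it with the given one. *)
Lemma P_plusE l P : negdef (affine R l) -> anti_stabilizing A B Q S R l P ->
  P_plus A B Q S R l = P.
Proof.
move=> Rn hP; have hP' : anti_stabilizing A B Q S R l (P_plus A B Q S R l).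
  exact: (xgetPex 0 (ex_intro _ P hP)).
have [s1 r1 l1] := (anti_stabilizing_lyap _ _).1 hP.
have [s2 r2 l2] := (anti_stabilizing_lyap _ _).1 hP'.
exact: (@lyap_ricc_uniq _ _ _ A B (affine Q l) (affine S l) (affine R l) Rn _ _ s2 s1 r2 r1 l2 l1).
Qed.

Lemma P_minusE l P : negdef (affine R l) -> stabilizing A B Q S R l P ->
  P_minus A B Q S R l = P.
Proof.
move=> Rn hP; have hP' : stabilizing A B Q S R l (P_minus A B Q S R l).
  exact: (xgetPex 0 (ex_intro _ P hP)).
have [s1 r1 l1] := (stabilizing_lyap _ _).1 hP.
have [s2 r2 l2] := (stabilizing_lyap _ _).1 hP'.
exact: (@lyapN_ricc_uniq _ _ _ A B (affine Q l) (affine S l) (affine R l) Rn _ _ s2 s1 r2 r1 l2 l1).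
Qed.

(** The domain provides only the anti-stabilizing solution; its reflection supplies the stabilizing
    one, and the positive definite shift between them is [Delta]. *)
Lemma riccati_domain_solutions l : controllable A B -> riccati_domain A B Q S R l ->
  [/\ anti_stabilizing A B Q S R l (P_plus A B Q S R l),
      stabilizing A B Q S R l (P_minus A B Q S R l) &
      posdef (Delta A B Q S R l)].
Proof.
move=> AB [Rn [P hP]]; have hP' := hP; rewrite -(P_plusE Rn hP) in hP'.
have [Ps r0 lP] := (anti_stabilizing_lyap _ _).1 hP'.
have [D [Dp r1 l1]] :=
  @ricc_reflection _ _ _ A B (affine Q l) (affine S l) (affine R l) Rn _ AB Ps r0 lP.
have st : stabilizing A B Q S R l (P_plus A B Q S R l - D).
  by apply/stabilizing_lyap; split => //; rewrite trmxD trmxN Ps Dp.1.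
have Pm := P_minusE Rn st; split; [exact: hP'|by rewrite Pm|].
by rewrite /Delta Pm opprB addrC subrK.
Qed.

Lemma feasible_nbhs l0 P0 :
  (forall i, (N i)^T = N i) -> (forall i, (Q i)^T = Q i) -> (forall i, (R i)^T = R i) ->
  posdef (affine N l0) -> negdef (affine R l0) -> posdef P0 ->
  anti_stabilizing A B Q S R l0 P0 ->
  nbhs l0 (feasible A B N Q S R).
Proof.
move=> Ns Qs Rs Np Rn Pp /anti_stabilizing_lyap[P0s r0 lA].
have lid : mcvg (nbhs l0) id l0 by exact: mcvg_id.
have cN : mcvg (nbhs l0) (affine N) (affine N l0) by exact: mcvg_affine.
have cQ : mcvg (nbhs l0) (affine Q) (affine Q l0) by exact: mcvg_affine.
have cS : mcvg (nbhs l0) (affine S) (affine S l0) by exact: mcvg_affine.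
have cR : mcvg (nbhs l0) (affine R) (affine R l0) by exact: mcvg_affine.
have Ru : affine R l0 \in unitmx.
  by have := posdef_unit (posdef_opp Rn); rewrite -scaleN1r unitmxZ ?unitrN1.
have cI : mcvg (nbhs l0) (fun l => invmx (affine R l)) (invmx (affine R l0)) by exact: mcvg_inv.
have cT : mcvg (nbhs l0) (fun l => P0 *m B + affine S l) (P0 *m B + affine S l0).
  by apply: mcvgD => //; exact: mcvg_cst.
have cA : mcvg (nbhs l0) (closed_loop A B S R P0) (closed_loop A B S R P0 l0).
  apply: mcvgB; first exact: mcvg_cst.
  apply: mcvgM; last exact: mcvg_tr.
  by apply: mcvgM => //; exact: mcvg_cst.
have cE : mcvg (nbhs l0) (riccati A B Q S R P0) 0.
  rewrite -r0; apply: mcvgB; first by apply: mcvgD => //; exact: mcvg_cst.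
  by apply: mcvgM; [exact: mcvgM|exact: mcvg_tr].
have cG : mcvg (nbhs l0) (fun l => gain B (affine R l)) (gain B (affine R l0)).
  apply: mcvgM; last exact: mcvg_cst.
  by apply: mcvgM; [exact: mcvg_cst|exact: mcvgN].
have [mu mu0 hmu] := posdef_coercive Pp.
have [kappa kappa0 hk] := lyap_perturb lA.
set g := abssum (gain B (affine R l0)) + 1.
have g0 : 0 < g by have := abssum_ge0 (gain B (affine R l0)); rewrite /g; lra.
(* The first entry keeps P0 + X positive definite. The second bounds the closed-loop change caused
   by X by kappa / 2, leaving the other half for D. *)
set eps := Num.min (mu / 4) (kappa / 2 / g).
have eps0 : 0 < eps by rewrite lt_min !divr_gt0.
have eps1 : eps <= mu / 4 by rewrite /eps ge_min lexx.
have eps2 : g * eps <= kappa / 2 by rewrite mulrC -ler_pdivlMr // /eps ge_min lexx orbT.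
have [delta delta0 hdelta] := ricc_pert_solve lA (ltW g0) eps0.
have k2 : 0 < kappa / 2 by rewrite divr_gt0.
have nN : \forall l \near nbhs l0, posdef (affine N l).
  by apply: mcvg_posdef cN Np => l; exact: affine_sym.
have nR : \forall l \near nbhs l0, posdef (- affine R l).
  have cNR : mcvg (nbhs l0) (fun l => - affine R l) (- affine R l0) by exact: mcvgN.
  apply: mcvg_posdef cNR (posdef_opp Rn) => l.
  by rewrite trmxN affine_sym.
have nE : \forall l \near nbhs l0,
    abssum (riccati A B Q S R P0 l - 0) < delta
  by exact: mcvg_abssumB.
have nD1 : \forall l \near nbhs l0,
    abssum (closed_loop A B S R P0 l - closed_loop A B S R P0 l0) < delta
  by exact: mcvg_abssumB.
have nD2 : \forall l \near nbhs l0,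
    abssum (closed_loop A B S R P0 l - closed_loop A B S R P0 l0) < kappa / 2
  by exact: mcvg_abssumB.
have nG : \forall l \near nbhs l0,
    abssum (gain B (affine R l) - gain B (affine R l0)) < 1
  by exact: mcvg_abssumB.
near=> l.
have Npl : posdef (affine N l) by near: l.
have Rnl : negdef (affine R l) by apply: negdef_opp; near: l.
set D := closed_loop A B S R P0 l - closed_loop A B S R P0 l0.
have Gb : abssum (gain B (affine R l)) <= g.
  have : abssum (gain B (affine R l) - gain B (affine R l0)) < 1 by near: l.
  have := abssumD (gain B (affine R l) - gain B (affine R l0)) (gain B (affine R l0)).
  by rewrite subrK /g; lra.
have D2 : abssum D < kappa / 2 by rewrite /D; near: l.
have [||||| X [Xs Xe XE]] := hdelta (riccati A B Q S R P0 l) D (gain B (affine R l)).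
- by apply: ricc_sym => //; exact: affine_sym.
- by apply: gain_sym; exact: affine_sym.
- by apply: ltW; rewrite -[riccati _ _ _ _ _ _ _]subr0; near: l.
- by apply: ltW; rewrite /D; near: l.
- exact: Gb.
have Ps : (P0 + X)^T = P0 + X by rewrite trmxD P0s Xs.
have aP : anti_stabilizing A B Q S R l (P0 + X).
  apply/anti_stabilizing_lyap; split; first exact: Ps.
    have -> : riccati A B Q S R (P0 + X) l = riccati A B Q S R P0 l
        + ((closed_loop A B S R P0 l)^T *m X + X *m closed_loop A B S R P0 l)
        + X *m gain B (affine R l) *m X.
      exact: (@ricc_add _ _ _ A B (affine Q l) (affine S l) (affine R l) Rnl P0 X Xs).
    (* Replacing the closed loop at l by the one at l0 plus D turns the expansion of [ricc_add] into
       the equation solved by X. *)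
    rewrite -XE /ricc_pert /D.
    rewrite !(trmxD, trmxN, mulmxDl, mulmxDr, mulmxN, mulNmx).
    by apply/matrixP => i j; rewrite !(addmxE, oppmxE); ring.
  have clE : closed_loop A B S R (P0 + X) l = closed_loop A B S R P0 l + gain B (affine R l) *m X.
    exact: (@cloop_add _ _ _ A B (affine S l) (affine R l) P0 X Xs).
  apply: hk; rewrite clE addrAC -/D.
  have h1 := abssumD D (gain B (affine R l) *m X).
  have h2 := abssumM (gain B (affine R l)) X.
  have h3 : abssum (gain B (affine R l)) * abssum X <= g * eps.
    by apply: ler_pM => //; exact: abssum_ge0.
  lra.
split => //.
  by split => //; exists (P0 + X).
rewrite (P_plusE Rnl aP); apply: coercive_perturb Ps hmu _.
rewrite addrAC subrr add0r; lra.
Unshelve. all: by end_near. Qed.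
End FeasibleSet.

(** * The barrier along an ultrafilter and the limit point *)

Lemma not_cvg_pinfty_ultra (K : realType) (v : nat -> K) :
  ~ (v @ \oo --> +oo) ->
  exists U (M : K), [/\ UltraFilter U, \oo `<=` U & U [set k | v k < M]].
Proof.
move=> /cvgryPge/existsNP[M hM].
(* Failure of divergence means that v k < M happens frequently, so restricting the filter to these
   indices keeps it proper. *)
have WP : ProperFilter (within [set k | v k < M] \oo).
  apply: Build_ProperFilter_ex => P hP; apply: contrapT => nP; apply: hM.
  have hP' : \forall k \near \oo, v k < M -> P k := hP.
  apply: filterS hP' => k /= hk; rewrite leNgt; apply/negP => /hk Pk.
  by apply: nP; exists k.
have [U [UU WU]] := ultraFilterLemma WP; exists U, M; split => //.
  by move=> Z hZ; apply: WU; rewrite /within /=; near=> k => _; near: k; exact: hZ.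
by apply: WU; rewrite /within /=; near=> k.
Unshelve. all: by end_near.
Qed.

Theorem theorem3 (K : realType) (n m p r : nat)
    (n_gt0 : (0 < n)%N) (m_gt0 : (0 < m)%N)
    (p_gt0 : (0 < p)%N) (r_gt0 : (0 < r)%N)
    (A : 'M[K]_n) (B : 'M[K]_(n, m)) (c : 'cV[K]_p) (Sigma : 'M[K]_n)
    (N : 'I_p.+1 -> 'M[K]_r) (Q : 'I_p.+1 -> 'M[K]_n)
    (S : 'I_p.+1 -> 'M[K]_(n, m)) (R : 'I_p.+1 -> 'M[K]_m)
    (N_sym : forall i, (N i)^T = N i)
    (Q_sym : forall i, (Q i)^T = Q i)
    (R_sym : forall i, (R i)^T = R i)
    (AB_controllable : controllable A B)
    (Sigma_psd : possemidef Sigma)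
    (t : K) (t_gt0 : 0 < t)
    (lambda : nat -> 'cV[K]_p) (lambda_bar : 'cV[K]_p)
    (lambda_feasible : forall k, feasible A B N Q S R (lambda k))
    (lambda_cvg : lambda @ \oo --> lambda_bar)
    (lambda_bar_boundary : boundary (feasible A B N Q S R) lambda_bar) :
  barrier A B c Sigma N Q S R t (lambda k) @[k --> \oo] --> +oo.
Proof.
have AB := AB_controllable.
case: lambda_bar_boundary => _ nint; apply: contrapT => /not_cvg_pinfty_ultra[U [M [UU oU vM]]].
apply: nint; have UP := @ultra_proper _ U UU.
have lcvg : mcvg U lambda lambda_bar.
  by apply: cvg_mcvg => V /lambda_cvg; exact: oU.
pose P k := P_plus A B Q S R (lambda k); pose P' k := P_minus A B Q S R (lambda k).
pose D k := Delta A B Q S R (lambda k).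
have Pp k : posdef (P k) by case: (lambda_feasible k).
have Rn k : negdef (affine R (lambda k)) by case: (lambda_feasible k) => _ [].
have Np k : posdef (affine N (lambda k)) by case: (lambda_feasible k).
have sol k : [/\ anti_stabilizing A B Q S R (lambda k) (P k),
    stabilizing A B Q S R (lambda k) (P' k) & posdef (D k)].
  by apply: riccati_domain_solutions => //; case: (lambda_feasible k).
have cN : mcvg U (fun k => affine N (lambda k)) (affine N lambda_bar) by exact: mcvg_affine.
 have cQ : mcvg U (fun k => affine Q (lambda k)) (affine Q lambda_bar) by exact: mcvg_affine.
have cS : mcvg U (fun k => affine S (lambda k)) (affine S lambda_bar) by exact: mcvg_affine.
 have cR : mcvg U (fun k => affine R (lambda k)) (affine R lambda_bar) by exact: mcvg_affine.
have [M1 hM1] : exists M, U [set k | abssum (P k) <= M].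
  apply: (ricc_bounded AB cQ cS cR Rn) => k; first exact: (Pp k).1.
  by have [[]] := sol k.
have [M2 hM2] : exists M, U [set k | abssum (P' k) <= M].
  by apply: (ricc_bounded AB cQ cS cR Rn) => k; have [_ []] := sol k.
have [Pb cP] := ultra_mcvg hM1; have [Pb' cP'] := ultra_mcvg hM2.
have cD : mcvg U D (Pb - Pb') by exact: mcvgB.
pose Nb := affine N lambda_bar; pose Rb := affine R lambda_bar.
have dN k := posdef_det_gt0 (Np k); have dR k := posdef_det_gt0 (posdef_opp (Rn k)).
have dP k := posdef_det_gt0 (Pp k).
have dD k : 0 < \det (D k) by apply: posdef_det_gt0; case: (sol k).
pose w k := t * ((c^T *m lambda k) 0 0 - \tr (Sigma *m P k)).
pose wb := t * ((c^T *m lambda_bar) 0 0 - \tr (Sigma *m Pb)).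
have cw : w @ U --> wb.
  apply: cvgM; first exact: cvg_cst.
  apply: cvgB; first by apply: mcvgM => //; exact: mcvg_cst.
  by apply: mcvg_trace; apply: mcvgM => //; exact: mcvg_cst.
(* Only the product is bounded below directly; since every factor has a finite limit, a nonzero
   limit of the product forces each limit to be nonzero. *)
pose q k := \det (affine N (lambda k)) * \det (P k) * \det (- affine R (lambda k)) * \det (D k).
have cq : q @ U --> \det Nb * \det Pb * \det (- Rb) * \det (Pb - Pb').
  by do 3!(apply: cvgM; last by apply: mcvg_det => //; exact: mcvgN); exact: mcvg_det.
have q0 k : 0 < q k by rewrite /q !mulr_gt0.
have vE k : barrier A B c Sigma N Q S R t (lambda k) = w k - ln (q k).
  rewrite /barrier /q !lnM ?posrE ?mulr_gt0 // /w; ring.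
have qb : expR (wb - 1 - M) <= \det Nb * \det Pb * \det (- Rb) * \det (Pb - Pb').
  (* Along U, w k - ln (q k) < M while w k >= wb - 1, so ln (q k) > wb - 1 - M. *)
  apply: (cvg_limit_ge cq).
  have wlow : \forall k \near U, wb - 1 <= w k.
    by apply: (cvgr_ge _ cw); rewrite ltrBlDr ltrDl.
  near=> k.
  have : barrier A B c Sigma N Q S R t (lambda k) < M by near: k.
  have : wb - 1 <= w k by near: k.
  rewrite vE => h1 h2; rewrite -[q k]lnK ?posrE // ler_expR; lra.
have d0 := lt_le_trans (expR_gt0 _) qb.
have psd_lim a (f : nat -> 'M[K]_a) L : mcvg U f L -> (forall k, posdef (f k)) ->
    \det L != 0 -> posdef L.
  move=> cf fp L0; apply: psd_unit_posdef; last by rewrite unitmxE unitfE.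
  by apply: mcvg_psd cf => k; exact: posdef_psd.
move: (lt0r_neq0 d0); rewrite !mulf_eq0 !negb_or => /andP[/andP[/andP[N0 P0] R0] D0].
have Nbp : posdef Nb by apply: psd_lim cN _ N0.
have Pbp : posdef Pb by apply: psd_lim cP _ P0.
have Rbn : negdef Rb.
  have cNR : mcvg U (fun k => - affine R (lambda k)) (- Rb) by exact: mcvgN.
  apply: negdef_opp; apply: psd_lim cNR _ R0 => k; exact: posdef_opp.
have Dbp : posdef (Pb - Pb') by apply: psd_lim cD _ D0 => k; case: (sol k).
apply: (feasible_nbhs N_sym Q_sym R_sym Nbp Rbn Pbp).
have Ru : Rb \in unitmx.
  by have := posdef_unit (posdef_opp Rbn); rewrite -scaleN1r unitmxZ ?unitrN1.
have cI : mcvg U (fun k => invmx (affine R (lambda k))) (invmx Rb) by exact: mcvg_inv.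
have ric (f : nat -> 'M[K]_n) L : mcvg U f L ->
   (forall k, riccati A B Q S R (f k) (lambda k) = 0) ->
   riccati A B Q S R L lambda_bar = 0.
  move=> cf f0.
  have cT : mcvg U (fun k => f k *m B + affine S (lambda k))
      (L *m B + affine S lambda_bar).
    by apply: mcvgD => //; apply: mcvgM => //; exact: mcvg_cst.
  have c1 : mcvg U (fun k => riccati A B Q S R (f k) (lambda k)) (riccati A B Q S R L lambda_bar).
    apply: mcvgB; last by apply: mcvgM; [exact: mcvgM|exact: mcvg_tr].
    apply: mcvgD => //; apply: mcvgD; apply: mcvgM => //; exact: mcvg_cst.
  apply: (mcvg_unique c1); apply: (@mcvg_near _ _ _ _ _ _ (fun=> 0)); last exact: mcvg_cst.
  by apply: nearW => k; rewrite f0.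
have ricP : riccati A B Q S R Pb lambda_bar = 0.
  by apply: ric cP _ => k; have [[]] := sol k.
have ricP' : riccati A B Q S R Pb' lambda_bar = 0.
  by apply: ric cP' _ => k; have [_ []] := sol k.
(* The limit of the stabilizing solutions enters as a second symmetric solution at the limit point,
   to be compared with Pb by [ricc_diff]. *)
have Ps' : Pb'^T = Pb'.
  by have := Dbp.1; rewrite trmxD trmxN Pbp.1 => /addrI/oppr_inj.
split; [exact: Pbp.1|exact: ricP|].
have Di := posdef_inv Dbp; have Du := posdef_unit Dbp.
rewrite /closed_loop -mulmxA.
apply: (controllable_spectrum AB (posdef_invR Rbn) Di).
have e :=
  @ricc_diff _ _ _ A B (affine Q lambda_bar) (affine S lambda_bar) Rb Rbn _ _ Pbp.1 Ps' ricP ricP'.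
rewrite mulmxA -/(cloop A B (affine S lambda_bar) Rb Pb) -/(gain B Rb).
set Cl := cloop _ _ _ _ _ in e *; set E := Pb - Pb' in e Di Du *.
(* Multiplying [ricc_diff] by E^-1 on both sides gives the Lyapunov equation for E^-1 that
   [controllable_spectrum] asks for. *)
have -> : gain B Rb = invmx E *m (Cl^T *m E + E *m Cl) *m invmx E.
  by rewrite e !mulmxA mulVmx // mul1mx -mulmxA mulmxV // mulmx1.
by rewrite mulmxDr mulmxDl !mulmxA mulmxK // mulVmx // mul1mx addrC.
Unshelve. all: by end_near. Qed.
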